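(* Fix any $\varepsilon>0$ and denote $\varphi_{\pm}(x)=\tfrac12\pm\sqrt{x(1-x)}$ for $x\in[0,1]$. For each $n\ge 1$ consider a jump sequence of order $n$ chosen uniformly at random among all jump sequences of order $n$, and let $\tau_n^{-}(k)$, $\tau_n^{+}(k)$ ($1\le k\le 2n$) be the first and last times at which some particle jumps from or to position $k$. Then as $n\to\infty$ the probability of the event $$\Bigl\{\max_{1\le k\le 2n}\bigl|n^{-2}\tau_n^{-}(k)-\varphi_{-}(k/2n)\bigr|<\varepsilon\Bigr\}\cap\Bigl\{\max_{1\le k\le 2n}\bigl|n^{-2}\tau_n^{+}(k)-\varphi_{+}(k/2n)\bigr|<\varepsilon\Bigr\}$$ tends to $1$.
   Context: Jump sequences of order $n$: there are $n$ particles numbered $1,\dots,n$ on the integer lattice $\mathbb{Z}$. Initially (time $0$) particle $k$ is in position $k$. At each of the discrete time steps $1,2,\dots,n^2$ exactly one particle jumps one step to the right; a particle may jump only if the position immediately to its right is unoccupied and lies in the interval $[1,2n]$. After exactly $n^2$ steps the system terminates in the state in which particle $k$ is in position $n+k$ for every $k$. A jump sequence of order $n$ is a complete sequence of instructions (which particle jumps at each time $1,\dots,n^2$) evolving the system from start to finish. (Jump sequences of order $n$ are in bijection with standard Young tableaux $(t_{i,j})_{i,j=1}^n$ of $n\times n$ square shape, where row $k$ of the tableau lists the times at which particle $n+1-k$ jumps.) The set of jump sequences is given the uniform probability measure. For a jump sequence and $1\le k\le 2n$, $\tau_n^{-}(k)$ and $\tau_n^{+}(k)$ denote respectively the first and the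 last time step at which some particle jumps from position $k$ or to position $k$. *)

(* Defs.v *)
(* MathComp / MathComp-Analysis *)
From HB Require Import structures.
From mathcomp Require Import all_boot all_order all_algebra.
From mathcomp Require Import all_classical all_reals all_analysis.

Set Implicit Arguments.
Unset Strict Implicit.
Unset Printing Implicit Defensive.

Import Order.TTheory GRing.Theory Num.Theory.
Import numFieldNormedType.Exports.

Local Open Scope nat_scope.

(* Particle number i.+1 is represented by i : 'I_n; a configuration gives the
   position of every particle. *)
Definition config (n : nat) := {ffun 'I_n -> nat}.

Definition init_config (n : nat) : config n := [ffun k : 'I_n => k.+1].

Definition final_config (n : nat) : config n := [ffun k : 'I_n => n + k.+1].

Definition jump (n : nat) (c : config n) (k : 'I_n) : config n :=
  [ffun j => if j == k then (c j).+1 else c j].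

Definition may_jump (n : nat) (c : config n) (k : 'I_n) : bool :=
  (1 <= (c k).+1 <= 2 * n) && [forall j, c j != (c k).+1].

(* An instruction sequence s names the particle that jumps at each time step;
   tnth s i is the instruction for time i.+1, so it acts on the configuration
   at time i. *)
Definition instructions (n : nat) := (n ^ 2).-tuple 'I_n.

Definition config_at (n : nat) (s : instructions n) (t : nat) : config n :=
  foldl (@jump n) (init_config n) (take t s).

Definition jump_sequence (n : nat) (s : instructions n) : bool :=
  [forall i : 'I_(n ^ 2), may_jump (config_at s i) (tnth s i)]
  && (config_at s (n ^ 2) == final_config n).

Definition jump_sequences (n : nat) : {set instructions n} :=
  [set s | jump_sequence s].

(* At time i.+1 some particle jumps from or to position k. *)
Definition touches (n : nat) (s : instructions n) (k : nat)
    (i : 'I_(n ^ 2)) : bool :=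
  let p := config_at s i (tnth s i) in (p == k) || (p.+1 == k).

(* The default values n ^ 2 and 0 of the iterated minimum and maximum are
   immaterial: all time steps lie in [1, n ^ 2], and in a jump sequence every
   position in [1, 2n] is touched at least once. *)
Definition tau_minus (n : nat) (s : instructions n) (k : nat) : nat :=
  \big[minn/n ^ 2]_(i < n ^ 2 | touches s k i) i.+1.

Definition tau_plus (n : nat) (s : instructions n) (k : nat) : nat :=
  \max_(i < n ^ 2 | touches s k i) i.+1.

Local Open Scope ring_scope.

Definition phi_minus (R : realType) (x : R) : R :=
  2^-1 - Num.sqrt (x * (1 - x)).

Definition phi_plus (R : realType) (x : R) : R :=
  2^-1 + Num.sqrt (x * (1 - x)).

(* Maxima of absolute values, so 0 is a neutral default. *)
Definition dev_minus (R : realType) (n : nat) (s : instructions n) : R :=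
  \big[Num.max/0]_(1 <= k < (2 * n).+1)
    `|(tau_minus s k)%:R / n%:R ^+ 2 - phi_minus (k%:R / (2 * n%:R))|.

Definition dev_plus (R : realType) (n : nat) (s : instructions n) : R :=
  \big[Num.max/0]_(1 <= k < (2 * n).+1)
    `|(tau_plus s k)%:R / n%:R ^+ 2 - phi_plus (k%:R / (2 * n%:R))|.

(* Probability of the event E for a uniformly random jump sequence. *)
Definition jump_prob (R : realType) (n : nat) (E : {set instructions n}) : R :=
  #|jump_sequences n :&: E|%:R / #|jump_sequences n|%:R.

(* Main.v *)
Require Import Defs.
From mathcomp Require Import all_boot all_order all_algebra.
From mathcomp Require Import all_classical all_reals all_analysis.
From mathcomp Require Import ring lra zify.
Import Order.TTheory GRing.Theory Num.Theory.
Import numFieldNormedType.Exports.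
Local Open Scope classical_set_scope.
Local Open Scope ring_scope.
Set Implicit Arguments.
Unset Strict Implicit.
Unset Printing Implicit Defensive.

(** Let N = n^2 and let c_m be the configuration at time m of a uniform jump
    sequence. The touching times are read off four statistics of c_m with values
    in 0..n. The displacement of the last particle and the number of particles
    that have moved increase in time and govern [tau_minus], above n and up to n
    respectively. The number of unfinished particles and the remaining
    displacement of the first particle decrease and govern [tau_plus]. A position
    is touched before (for [tau_minus]) or after (for [tau_plus]) time m exactly
    when the statistic at time m exceeds some level y. So the theorem says that
    Y / n is close to sin th when the elapsed time, counted from the end where
    Y = 0, is N (1 - cos th) / 2 with th at most pi / 2, and that Y = n later on.

    Counting is exact. The number of ways to reach c in m steps is
    m! V(c) / prod_k (c_k - 1)! and the number of ways to finish from c is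
    (N - m)! V(c) / prod_k (2n - c_k)!, where V is the Vandermonde product
    ([nb_beforeE], [nb_afterE]); both recursions are instances of the polynomial
    identity [sum_shift_vdm]. Let c' be c after a jump of particle k. If a and a'
    jump sequences visit c at time m and c' at time m + 1, and b of them do both,
    then the Vandermonde products cancel and
    b^2 (m + 1)(N - m) = a a' c_k (2n - c_k)  ([visits_sq]). When a statistic
    moves between j and j + 1, the jump starts at n + j or n - j, so that the last
    factor is n^2 - j^2.

    The second idea extends the argument of Vershik and Kerov for the first row
    of a random Young diagram. By the Cauchy-Schwarz inequality, if
    (w(j+1) - w(j))^2 (n^2 - j^2) <= K^2 w(j) w(j+1) for all j < n, then one time
    step changes E w(Y_m) by at most K / sqrt ((m + 1)(N - m)) times the geometric
    mean of its two values ([mean_step]). Hence log E w(Y_m) is Lipschitz with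
    constant K with respect to the angle acos (1 - 2m/N)
    ([stat_mean_lipschitz]). The weight prod_{i<j} (1 + s / sqrt (n^2 - i^2)),
    roughly exp (s asin (j/n)), and its inverse satisfy the condition with K = s.

    Markov's inequality, from the time at which Y = 0, gives the upper tail of Y.
    For the lower tail the inverse weight is carried backwards from a time
    slightly after N/2. At that time Y = n with high probability: otherwise a dual
    statistic, which vanishes at the other end of time, would already be n, and
    its own upper tail excludes this. With s = n^(1/4) all error probabilities
    are of order exp (- e n^(1/4)), small enough for a union bound over all
    times and levels. *)

(** * A shift identity for Vandermonde products *)

Definition vdm (R : comNzRingType) (n : nat) (x : 'I_n -> R) : R :=
  \prod_(i < n) \prod_(j < n | (i < j)%N) (x j - x i).

Lemma vdm_det (R : comNzRingType) (n : nat) (x : 'I_n -> R) :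
  vdm x = \det (Vandermonde n (\row_j x j)).
Proof.
rewrite det_Vandermonde; apply: eq_bigr => i _; apply: eq_bigr => j _.
by rewrite !mxE.
Qed.

Lemma vdm_eq0 (R : comNzRingType) (n : nat) (x : 'I_n -> R) (i j : 'I_n) :
  i != j -> x i = x j -> vdm x = 0.
Proof.
wlog lt_ij : i j / (i < j)%N => [hw neq_ij xij|_ xij].
  case: (ltngtP i j) => [/hw|/hw|/val_inj/eqP]; [exact| |by rewrite (negPf neq_ij)].
  by apply; [rewrite eq_sym|].
by rewrite /vdm (bigD1 i) //= (bigD1 j) //= xij subrr !mul0r.
Qed.

(** Expanding the k-th determinant along its k-th column gives the k-th diagonal
    entry of the product on the right. *)
Lemma sum_det_replace_col (R : comNzRingType) (n : nat) (V W : 'M[R]_n) :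
  \sum_k \det (\matrix_(i, j) if j == k then W i j else V i j) =
  \tr (\adj V *m W).
Proof.
apply: eq_bigr => k _; rewrite (expand_det_col _ k) mxE.
apply: eq_bigr => i _; rewrite !mxE eqxx mulrC; congr (_ * _).
rewrite /cofactor; congr (_ * \det _); apply/matrixP => a b.
by rewrite !mxE eq_sym (negPf (neq_lift _ _)).
Qed.

(** Only the leading coefficient of the lower-order part of (X + t)^i is needed:
    it is what survives in the trace computed below. *)
Lemma shift_pow_lower (R : comNzRingType) (t : R) (i : nat) :
  let r := ('X + t%:P) ^+ i - 'X^i : {poly R} in
  (size r <= i)%N /\ ('X * r)`_i = t *+ i.
Proof.
elim: i => [|i [IHs IHc]] /=; first by rewrite !expr0 subrr mulr0 coef0 size_poly0.
set r := _ - _ in IHs IHc.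
have e : ('X + t%:P) ^+ i.+1 - 'X^(i.+1) = 'X * r + t%:P * (r + 'X^i) :> {poly R}.
  by rewrite /r !exprS; ring.
split; rewrite e.
  apply: (leq_trans (size_polyD _ _)); rewrite geq_max; apply/andP; split.
    by rewrite mulrC; apply: (leq_trans (size_polyMleq _ _)); rewrite size_polyX addn2 /= ltnS.
  rewrite mul_polyC; apply: (leq_trans (size_scale_leq _ _)).
  apply: (leq_trans (size_polyD _ _)); rewrite geq_max size_polyXn leqnn andbT.
  exact: leqW.
rewrite coefXM /= coefD IHc mul_polyC coefZ coefD coefXn eqxx.
by rewrite (nth_default _ IHs) add0r mulr1 mulrSr.
Qed.

(** Multiplying by al + be X after the substitution X := X + t maps the i-th power
    to be X^(i+1) plus a polynomial of degree at most i, in which X^i has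
    coefficient al + be t i. Shifting the k-th point replaces the k-th column of
    the Vandermonde matrix V. The sum over k is therefore the trace of
    adj V (P V + be V diag x), where P is lower triangular with diagonal entries
    al + be t i, and adj V V = det V turns it into the right-hand side. *)
Lemma sum_shift_vdm (R : comNzRingType) (n : nat) (x : 'I_n -> R) (al be t : R) :
  \sum_k (al + be * x k) * vdm (fun j => if j == k then x j + t else x j) =
  (\sum_(i < n) (al + be * t *+ i) + be * \sum_k x k) * vdm x.
Proof.
pose V := Vandermonde n (\row_j x j).
pose p i : {poly R} := (al%:P + be *: 'X) * ('X + t%:P) ^+ i - be *: 'X^(i.+1).
have pE i : p i = al *: 'X^i + (al *: (('X + t%:P) ^+ i - 'X^i)
     + be *: ('X * (('X + t%:P) ^+ i - 'X^i))).
  by rewrite /p exprS -!mul_polyC; move: (('X + t%:P) ^+ i) ('X^i) => Q Xi; ring.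
have p_size i : (size (p i) <= i.+1)%N.
  have [rs _] := shift_pow_lower t i.
  rewrite pE; apply: (leq_trans (size_polyD _ _)); rewrite geq_max; apply/andP; split.
    by apply: (leq_trans (size_scale_leq _ _)); rewrite size_polyXn.
  apply: (leq_trans (size_polyD _ _)); rewrite geq_max; apply/andP; split.
  - by apply: (leq_trans (size_scale_leq _ _)); apply: leqW.
  - apply: (leq_trans (size_scale_leq _ _)); rewrite mulrC.
    by apply: (leq_trans (size_polyMleq _ _)); rewrite size_polyX addn2 /= ltnS.
have p_coef i : (p i)`_i = al + be * t *+ i.
  have [rs rc] := shift_pow_lower t i.
  rewrite pE !coefD !coefZ coefXn eqxx (nth_default _ rs) rc mulr0 add0r mulr1.
  by rewrite mulrnAr.
pose W := \matrix_(i < n, k < n) ((al + be * x k) * (x k + t) ^+ i).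
pose P := \matrix_(i < n, l < n) (p i)`_l.
have WE : W = P *m V + be *: (V *m diag_mx (\row_j x j)).
  apply/matrixP => i k; rewrite !mxE.
  have -> : \sum_j P i j * V j k = (p i).[x k].
    rewrite (@horner_coef_wide _ n) ?(leq_trans (p_size i)) //.
    by apply: eq_bigr => l _; rewrite !mxE.
  rewrite (bigD1 k) //= big1 => [|j /negPf jk]; last by rewrite !mxE jk mulr0n mulr0.
  rewrite !mxE eqxx mulr1n addr0 /p.
  rewrite !hornerE exprS /=; ring.
have -> : \sum_k (al + be * x k) * vdm (fun j => if j == k then x j + t else x j) =
   \tr (\adj V *m W).
  rewrite -sum_det_replace_col; apply: eq_bigr => k _.
  rewrite vdm_det.
  rewrite (expand_det_col _ k) [RHS](expand_det_col _ k) big_distrr /=.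
  apply: eq_bigr => i _; rewrite !mxE eqxx mulrA; congr (_ * _).
  rewrite /cofactor; congr (_ * \det _); apply/matrixP => a b.
  by rewrite !mxE eq_sym (negPf (neq_lift _ _)).
rewrite WE mulmxDr mxtraceD -scalemxAr mxtraceZ mxtrace_mulC -mulmxA mul_mx_adj.
rewrite mulmxA mul_adj_mx -vdm_det mul_mx_scalar mul_scalar_mx !mxtraceZ.
rewrite mxtrace_diag.
have -> : \tr P = \sum_(i < n) (al + be * t *+ i).
  by apply: eq_bigr => i _; rewrite !mxE p_coef.
under [X in _ + _ * (_ * X)]eq_bigr do rewrite mxE.
ring.
Qed.

(** * Configurations and their Vandermonde weights *)

(** The configurations that respect the order of the particles; all the reachable
    ones are of this kind. *)
Definition valid (n : nat) (c : config n) : bool :=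
  [forall i : 'I_n, forall j : 'I_n, (i < j)%N ==> (c i < c j)%N] &&
  [forall i, (0 < c i <= 2 * n)%N].

Lemma validP (n : nat) (c : config n) :
  reflect ((forall i j : 'I_n, (i < j)%N -> (c i < c j)%N) /\
           (forall i, (0 < c i <= 2 * n)%N)) (valid c).
Proof.
apply: (iffP andP) => -[h1 h2]; split.
- by move=> i j; move/forallP/(_ i)/forallP/(_ j)/implyP: h1.
- by move=> i; move/forallP: h2.
- by apply/forallP => i; apply/forallP => j; apply/implyP; apply: h1.
- exact/forallP.
Qed.

Lemma valid_inj (n : nat) (c : config n) : valid c -> injective c.
Proof.
move=> /validP[h _] i j cij.
by case: (ltngtP i j) => [/h|/h|/val_inj //]; rewrite cij ltnn.
Qed.

Lemma valid_init (n : nat) : valid (init_config n).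
Proof.
apply/validP; split=> [i j|i]; rewrite !ffunE ?ltnS //.
have := ltn_ord i; lia.
Qed.

Lemma may_jumpP (n : nat) (c : config n) (k : 'I_n) :
  reflect ((c k < 2 * n)%N /\ forall j, c j != (c k).+1) (may_jump c k).
Proof. by apply: (iffP andP) => -[h1 /forallP h2]. Qed.

Lemma jumpE (n : nat) (c : config n) (k j : 'I_n) :
  jump c k j = (if j == k then (c j).+1 else c j).
Proof. by rewrite ffunE. Qed.

Lemma valid_jump (n : nat) (c : config n) (k : 'I_n) :
  valid c -> may_jump c k -> valid (jump c k).
Proof.
move=> /validP[h1 h2] /may_jumpP[h3 h4]; apply/validP; split=> [i j ij|i].
  have := h1 _ _ ij; rewrite !jumpE.
  case: eqP => [ik|_]; case: eqP => [jk|_] //; last lia.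
  by rewrite ik => cij; have := h4 j; lia.
by rewrite jumpE; have := h2 i; case: eqP => [->|_] //; lia.
Qed.

Definition unjump (n : nat) (c : config n) (k : 'I_n) : config n :=
  [ffun j => if j == k then (c j).-1 else c j].

Lemma unjumpK (n : nat) (c : config n) (k : 'I_n) :
  (0 < c k)%N -> jump (unjump c k) k = c.
Proof.
by move=> ck; apply/ffunP => j; rewrite !ffunE; case: eqP => // ->; rewrite prednK.
Qed.

Lemma jumpK (n : nat) (c : config n) (k : 'I_n) : unjump (jump c k) k = c.
Proof. by apply/ffunP => j; rewrite !ffunE; case: eqP. Qed.

Lemma may_unjump (n : nat) (c : config n) (k : 'I_n) :
  valid c -> valid (unjump c k) -> may_jump (unjump c k) k.
Proof.
move=> vc vu; have [_ h2] := validP _ vc; have [_ h2'] := validP _ vu.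
have := h2 k; have := h2' k; rewrite ffunE eqxx => p1 p2.
apply/may_jumpP; rewrite ffunE eqxx; split; first lia.
move=> j; rewrite ffunE; case: (eqVneq j k) => [->|jk]; first lia.
apply: contra jk => /eqP e; apply/eqP/(valid_inj vc); lia.
Qed.

Lemma sum_jump (n : nat) (c : config n) (k : 'I_n) :
  (\sum_j jump c k j = (\sum_j c j).+1)%N.
Proof.
rewrite (bigD1 k) //= [in RHS](bigD1 k) //= jumpE eqxx addSn; congr (_ + _).+1.
by apply: eq_bigr => j /negPf jk; rewrite jumpE jk.
Qed.

Definition cvdm (R : realFieldType) (n : nat) (c : config n) : R :=
  vdm (fun i => (c i)%:R : R).

Lemma cvdm_gt0 (R : realFieldType) (n : nat) (c : config n) :
  valid c -> 0 < cvdm R c.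
Proof.
move=> /validP[h _]; apply: prodr_gt0 => i _; apply: prodr_gt0 => j ij.
by rewrite subr_gt0 ltr_nat h.
Qed.

Lemma cvdm_eq0 (R : realFieldType) (n : nat) (c : config n) (i j : 'I_n) :
  i != j -> c i = c j -> cvdm R c = 0.
Proof. by move=> ij cij; apply: (vdm_eq0 ij); rewrite cij. Qed.

(** A jump is blocked either by the wall at 2n, where the factor 2n - c_k
    vanishes, or by a particle, on which the jump would create a repeated point.
    So the weight recursions may be summed over all particles. *)
Lemma blocked_jump_vdm (R : realFieldType) (n : nat) (c : config n) (k : 'I_n) :
  valid c -> ~~ may_jump c k -> (2 * n - c k)%:R * cvdm R (jump c k) = 0.
Proof.
move=> /validP[h1 h2]; rewrite /may_jump negb_and /= -leqNgt => /orP[ck|].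
  suff -> : (2 * n - c k = 0)%N by rewrite mul0r.
  by have := h2 k; lia.
move=> /forallPn[j /negPn/eqP cj]; rewrite (@cvdm_eq0 _ _ _ j k) ?mulr0 //.
  by apply/eqP => jk; move: cj; rewrite jk; lia.
by rewrite !jumpE eqxx; case: eqP => // jk; move: cj; rewrite jk; lia.
Qed.

(** The counterpart for backward jumps, with the wall at 1 instead of 2n. *)
Lemma blocked_unjump_vdm (R : realFieldType) (n : nat) (c : config n) (k : 'I_n) :
  valid c -> ~~ valid (unjump c k) -> (c k).-1%:R * cvdm R (unjump c k) = 0.
Proof.
move=> vc; apply: contraNeq; rewrite mulf_eq0 negb_or => /andP[ck hv].
have [h1 h2] := validP _ vc.
apply/validP; split=> [i j ij|i]; last first.
  rewrite ffunE; have := h2 i; case: eqP => [->|_] //.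
  by move: ck; rewrite pnatr_eq0; lia.
have := h1 _ _ ij; rewrite !ffunE.
case: eqP => [ik|ik]; case: eqP => [jk|jk] //; first by have := h2 i; lia.
  by lia.
move=> cij; rewrite ltn_neqAle; apply/andP; split; last lia.
apply: contra hv => /eqP e; apply/eqP/(@cvdm_eq0 _ _ _ i j).
  by rewrite -val_eqE /= ltn_eqF.
by rewrite !ffunE jk eqxx; case: eqP => // _; rewrite -jk.
Qed.

(** Up to the factor m!, the number of ways to reach c in m steps: this is
    Frobenius' formula for standard tableaux in terms of the shifted row lengths. *)
Definition fwd_weight (R : realFieldType) (n : nat) (c : config n) : R :=
  cvdm R c / \prod_k ((c k).-1)`!%:R.

(** Up to the factor (n^2 - m)!, the number of ways to finish from c. The
    complement of the shape in the square has shifted row lengths 2n - c_k, and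
    hence the same Vandermonde product up to sign. *)
Definition bwd_weight (R : realFieldType) (n : nat) (c : config n) : R :=
  cvdm R c / \prod_k ((2 * n - c k)`!)%:R.

Lemma prod_fact_gt0 (R : realFieldType) (I : finType) (f : I -> nat) :
  0 < \prod_k ((f k)`!)%:R :> R.
Proof. by apply: prodr_gt0 => k _; rewrite ltr0n fact_gt0. Qed.

Lemma fwd_weight_gt0 (R : realFieldType) (n : nat) (c : config n) :
  valid c -> 0 < fwd_weight R c.
Proof. by move=> vc; rewrite divr_gt0 ?cvdm_gt0 ?prod_fact_gt0. Qed.

Lemma bwd_weight_gt0 (R : realFieldType) (n : nat) (c : config n) :
  valid c -> 0 < bwd_weight R c.
Proof. by move=> vc; rewrite divr_gt0 ?cvdm_gt0 ?prod_fact_gt0. Qed.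

Lemma bwd_weight_jump (R : realFieldType) (n : nat) (c : config n) (k : 'I_n) :
  (c k < 2 * n)%N -> bwd_weight R (jump c k) =
  (2 * n - c k)%:R * cvdm R (jump c k) / \prod_k ((2 * n - c k)`!)%:R.
Proof.
move=> ck; rewrite /bwd_weight (bigD1 k) //= [in RHS](bigD1 k) //=.
under eq_bigr => j /negPf jk do rewrite jumpE jk.
rewrite jumpE eqxx (_ : 2 * n - c k = (2 * n - (c k).+1).+1)%N; last lia.
rewrite factS natrM.
have h : \prod_(i < n | i != k) ((2 * n - c i)`!)%:R != 0 :> R.
  by apply/prodf_neq0 => i _; rewrite pnatr_eq0 -lt0n fact_gt0.
by field; rewrite h nat1r !pnatr_eq0 -!lt0n !fact_gt0.
Qed.

Lemma fwd_weight_unjump (R : realFieldType) (n : nat) (c : config n) (k : 'I_n) :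
  (1 < c k)%N -> fwd_weight R (unjump c k) =
  (c k).-1%:R * cvdm R (unjump c k) / \prod_k ((c k).-1)`!%:R.
Proof.
move=> ck; rewrite /fwd_weight (bigD1 k) //= [in RHS](bigD1 k) //=.
under eq_bigr => j /negPf jk do rewrite ffunE jk.
have ck0 : (0 < (c k).-1)%N by lia.
rewrite ffunE eqxx -{2 3}(prednK ck0) factS natrM.
have h : \prod_(i < n | i != k) ((c i).-1)`!%:R != 0 :> R.
  by apply/prodf_neq0 => i _; rewrite pnatr_eq0 -lt0n fact_gt0.
by field; rewrite h nat1r !pnatr_eq0 -!lt0n !fact_gt0.
Qed.

(** By [sum_shift_vdm] with t = 1 and coefficients 2n - c_k. *)
Lemma bwd_weight_rec (R : realFieldType) (n L : nat) (c : config n) :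
  valid c -> (\sum_k c k + L = \sum_k final_config n k)%N ->
  \sum_(k | may_jump c k) bwd_weight R (jump c k) = L%:R * bwd_weight R c.
Proof.
move=> vc cL.
have cle k : (c k <= 2 * n)%N by have [_ /(_ k)/andP[]] := validP _ vc.
rewrite (eq_bigr (fun k => ((2 * n)%:R + (-1) * (c k)%:R) *
   vdm (fun j => if j == k then (c j)%:R + 1 else (c j)%:R) *
   (\prod_k ((2 * n - c k)`!)%:R)^-1)); last first.
  move=> k /may_jumpP[ck _]; rewrite bwd_weight_jump //; congr (_ * _ * _).
    by rewrite natrB // mulN1r.
  apply: eq_bigr => i _; apply: eq_bigr => j _; rewrite !jumpE.
  by do 2 case: eqP; rewrite ?[in LHS]mulrSr //= ?natr1 .
rewrite -mulr_suml big_mkcond /=.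
rewrite (eq_bigr (fun k => ((2 * n)%:R + (-1) * (c k)%:R) *
   vdm (fun j => if j == k then (c j)%:R + 1 else (c j)%:R))); last first.
  move=> k _; case: ifPn => // nk; apply/esym.
  rewrite -(blocked_jump_vdm R vc nk); congr (_ * _).
    by rewrite natrB // mulN1r.
  apply: eq_bigr => i _; apply: eq_bigr => j _; rewrite !jumpE.
  by do 2 case: eqP; rewrite -?natr1.
rewrite (@sum_shift_vdm _ _ (fun k => (c k)%:R)) /bwd_weight mulrA; congr (_ * _ * _).
have -> : \sum_(i < n) ((2 * n)%:R + -1 * 1 *+ i) = (\sum_k final_config n k)%:R :> R.
  rewrite (reindex_inj rev_ord_inj) natr_sum; apply: eq_bigr => i _ /=.
  rewrite mulr1 mulNrn -natrB ?ffunE; last by have := ltn_ord i; lia.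
  by congr (_%:R); have := ltn_ord i; lia.
rewrite -cL natrD natr_sum; ring.
Qed.

(** By [sum_shift_vdm] with t = -1 and coefficients c_k - 1. *)
Lemma fwd_weight_rec (R : realFieldType) (n m : nat) (c : config n) :
  valid c -> (\sum_k c k = \sum_k init_config n k + m)%N ->
  \sum_(k | valid (unjump c k)) fwd_weight R (unjump c k) = m%:R * fwd_weight R c.
Proof.
move=> vc cL; have [_ c0] := validP _ vc.
have unE k : (c k).-1%:R * cvdm R (unjump c k) = (-1 + 1 * (c k)%:R) *
   vdm (fun j => if j == k then (c j)%:R + -1 else (c j)%:R).
  congr (_ * _); first by rewrite -subn1 natrB ?mul1r 1?addrC //; have := c0 k; lia.
  have c0' j : (c j).-1%:R = (c j)%:R + -1 :> R.
    by rewrite -subn1 natrB //; have := c0 j; lia.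
  apply: eq_bigr => i _; apply: eq_bigr => j _; rewrite !ffunE.
  by do 2 case: eqP; rewrite ?c0'.
rewrite (eq_bigr (fun k => (c k).-1%:R * cvdm R (unjump c k) *
   (\prod_k ((c k).-1)`!%:R)^-1)); last first.
  move=> k vu; rewrite fwd_weight_unjump //.
  by have [_ /(_ k)] := validP _ vu; rewrite ffunE eqxx; lia.
rewrite -mulr_suml big_mkcond /=.
rewrite (eq_bigr (fun k => (-1 + 1 * (c k)%:R) *
   vdm (fun j => if j == k then (c j)%:R + -1 else (c j)%:R))); last first.
  by move=> k _; rewrite -unE; case: ifPn => // nk; rewrite blocked_unjump_vdm.
rewrite (@sum_shift_vdm _ _ (fun k => (c k)%:R)) /fwd_weight mulrA; congr (_ * _ * _).
rewrite -natr_sum cL natrD natr_sum !mul1r addrA -big_split /= big1 ?add0r // => i _.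
by rewrite ffunE mulNrn -natr1; ring.
Qed.

(** * Counting jump sequences through a configuration *)

Lemma valid_gap (n : nat) (c : config n) (i j : 'I_n) :
  valid c -> (i <= j)%N -> (c i + (j - i) <= c j)%N.
Proof.
move=> vc; have [h _] := validP _ vc; move e : (j - i)%N => d.
elim: d i e => [|d IH] i e ij.
  by rewrite addn0 (_ : i = j) //; apply/val_inj => /=; lia.
have i1n : (i.+1 < n)%N by have := ltn_ord j; lia.
have {}IH : (c (Ordinal i1n) + d <= c j)%N by apply: IH => /=; lia.
by have := h i (Ordinal i1n) (ltnSn i); lia.
Qed.

Lemma valid_le_final (n : nat) (c : config n) (k : 'I_n) :
  valid c -> (c k <= final_config n k)%N.
Proof.
move=> vc; have [_ h] := validP _ vc; have kn := ltn_ord k.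
have n1 : (n.-1 < n)%N by lia.
have kl : (k <= Ordinal n1)%N by rewrite /=; lia.
have /= := valid_gap vc kl.
by have := h (Ordinal n1); rewrite ffunE; lia.
Qed.

Lemma valid_ge_init (n : nat) (c : config n) (k : 'I_n) :
  valid c -> (init_config n k <= c k)%N.
Proof.
move=> vc; have [_ h] := validP _ vc; have kn := ltn_ord k.
have n0 : (0 < n)%N by lia.
have /= := @valid_gap _ _ (Ordinal n0) k vc (leq0n _).
by have := h (Ordinal n0); rewrite ffunE; lia.
Qed.

Lemma leq_config_sum_eq (n : nat) (c d : config n) :
  (forall k, c k <= d k)%N -> (\sum_k c k = \sum_k d k)%N -> c = d.
Proof.
move=> h /eqP e; apply/ffunP => k; apply/eqP.
have := leqif_sum (fun k (_ : true) => leqif_eq (h k)).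
by case=> _; rewrite e => /esym/forallP/(_ k).
Qed.

Lemma prod_sub_fact (n M : nat) :
  (M <= n)%N -> (\prod_(j < n | j < M) (M - j) = M`!)%N.
Proof.
by move=> h; rewrite (big_ord_narrow h) -ffactnn ffact_prod.
Qed.

Lemma bwd_weight_final (R : realFieldType) (n : nat) :
  bwd_weight R (final_config n) = 1.
Proof.
rewrite /bwd_weight (_ : cvdm _ _ = \prod_k ((2 * n - final_config n k)`!)%:R).
  by rewrite divff // gt_eqF ?prod_fact_gt0.
apply: eq_bigr => i _; rewrite ffunE.
have ->: (2 * n - (n + i.+1) = n - i.+1)%N by lia.
rewrite -(@prod_sub_fact n); last by lia.
rewrite natr_prod (reindex_inj rev_ord_inj) /=; apply: eq_big => j.
  by have := ltn_ord j; have := ltn_ord i; lia.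
move=> ji; rewrite !ffunE -natrB /=; last by have := ltn_ord j; lia.
by congr (_%:R); have := ltn_ord j; lia.
Qed.

Lemma fwd_weight_init (R : realFieldType) (n : nat) :
  fwd_weight R (init_config n) = 1.
Proof.
rewrite /fwd_weight (_ : cvdm _ _ = \prod_k ((init_config n k).-1`!)%:R).
  by rewrite divff // gt_eqF ?prod_fact_gt0.
rewrite /cvdm /vdm (exchange_big_dep xpredT) //=; apply: eq_bigr => j _.
rewrite ffunE /= -(@prod_sub_fact n); last by rewrite ltnW.
rewrite natr_prod; apply: eq_bigr => i ij.
by rewrite !ffunE -natrB ?subSS //; lia.
Qed.

Lemma big_tuple0 (A : Type) (idx : A) (op : Monoid.com_law idx) (T : finType)
    (F : seq T -> A) :
  \big[op/idx]_(t : 0.-tuple T) F t = F [::].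
Proof.
rewrite (bigD1 [tuple]) //= big1 ?Monoid.mulm1 // => t /eqP[].
exact: tuple0.
Qed.

Lemma big_tuple_cons (A : Type) (idx : A) (op : Monoid.com_law idx) (T : finType)
    (m : nat) (F : seq T -> A) :
  \big[op/idx]_(t : m.+1.-tuple T) F t =
  \big[op/idx]_(x : T) \big[op/idx]_(t : m.-tuple T) F (x :: t).
Proof.
rewrite pair_big /= (reindex (fun p : T * m.-tuple T => [tuple of p.1 :: p.2])) //=.
exists (fun t : m.+1.-tuple T => (thead t, [tuple of behead t])) => [[x t] _|t _].
  by congr pair; apply/val_inj.
by rewrite [t]tuple_eta; apply/val_inj.
Qed.

Lemma big_tuple_cat (A : Type) (idx : A) (op : Monoid.com_law idx) (T : finType)
    (N m L : nat) (F : seq T -> A) : N = (m + L)%N ->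
  \big[op/idx]_(t : N.-tuple T) F t =
  \big[op/idx]_(u : m.-tuple T) \big[op/idx]_(v : L.-tuple T) F (u ++ v).
Proof.
move=> ->; elim: m F => [|m IH] F.
  by rewrite (big_tuple0 _ (fun u => \big[op/idx]_(v : L.-tuple T) F (u ++ v))).
rewrite addSn big_tuple_cons.
rewrite (big_tuple_cons _ _ (fun u => \big[op/idx]_(v : L.-tuple T) F (u ++ v))).
by apply: eq_bigr => x _; rewrite (IH (fun w => F (x :: w))).
Qed.

Lemma big_tuple_rcons (A : Type) (idx : A) (op : Monoid.com_law idx) (T : finType)
    (m : nat) (F : seq T -> A) :
  \big[op/idx]_(t : m.+1.-tuple T) F t =
  \big[op/idx]_(x : T) \big[op/idx]_(t : m.-tuple T) F (rcons t x).
Proof.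
rewrite (big_tuple_cat _ _ (esym (addn1 m))) exchange_big /=.
rewrite (big_tuple_cons _ _ (fun v => \big[op/idx]_(t : m.-tuple T) F (t ++ v))).
apply: eq_bigr => x _.
rewrite (big_tuple0 _ (fun v => \big[op/idx]_(t : m.-tuple T) F (t ++ x :: v))).
by apply: eq_bigr => t _; rewrite cats1.
Qed.

Fixpoint valid_path (n : nat) (c : config n) (w : seq 'I_n) : bool :=
  if w is k :: w' then may_jump c k && valid_path (jump c k) w' else true.

Definition run (n : nat) (c : config n) (w : seq 'I_n) : config n :=
  foldl (@jump n) c w.

Lemma valid_path_cat (n : nat) (c : config n) (u v : seq 'I_n) :
  valid_path c (u ++ v) = valid_path c u && valid_path (run c u) v.
Proof. by elim: u c => [|k u IH] c //=; rewrite IH andbA. Qed.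

Lemma run_cat (n : nat) (c : config n) (u v : seq 'I_n) :
  run c (u ++ v) = run (run c u) v.
Proof. by rewrite /run foldl_cat. Qed.

Lemma valid_run (n : nat) (c : config n) (w : seq 'I_n) :
  valid c -> valid_path c w -> valid (run c w).
Proof.
elim: w c => [|k w IH] c //= vc /andP[mk]; apply: IH; exact: valid_jump.
Qed.

Lemma sum_run (n : nat) (c : config n) (w : seq 'I_n) :
  (\sum_k run c w k = \sum_k c k + size w)%N.
Proof.
by elim: w c => [|k w IH] c /=; rewrite ?addn0 // IH sum_jump addSnnS.
Qed.

Lemma valid_pathP (n : nat) (c : config n) (x0 : 'I_n) (w : seq 'I_n) :
  reflect (forall i, (i < size w)%N -> may_jump (run c (take i w)) (nth x0 w i))
          (valid_path c w).
Proof.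
elim: w c => [|k w IH] c /=; first by apply: ReflectT.
apply: (iffP andP) => [[mk /IH h] [|i] //= iw|h]; first by rewrite ltnS in iw; apply: h.
split; first by have := h 0%N; apply.
by apply/IH => i iw; have := h i.+1; apply.
Qed.

Lemma jump_sequenceE (n : nat) (s : instructions n) :
  jump_sequence s = valid_path (init_config n) s
                    && (run (init_config n) s == final_config n).
Proof.
rewrite /jump_sequence /config_at take_oversize ?size_tuple //; congr (_ && _).
apply/forallP/idP => [h|h i].
  case: (posnP (n ^ 2)%N) => [e|n2].
    by rewrite (@size0nil _ s) // size_tuple.
  apply/(valid_pathP _ (tnth s (Ordinal n2))) => i; rewrite size_tuple => iN.
  by have := h (Ordinal iN); rewrite (tnth_nth (tnth s (Ordinal n2))).
by rewrite (tnth_nth (tnth s i)); move/valid_pathP: h; apply; rewrite size_tuple.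
Qed.

Definition nb_after (n L : nat) (c : config n) : nat :=
  \sum_(v : L.-tuple 'I_n) (valid_path c v && (run c v == final_config n)).

Definition nb_before (n m : nat) (c : config n) : nat :=
  \sum_(u : m.-tuple 'I_n) (valid_path (init_config n) u && (run (init_config n) u == c)).

Lemma nb_afterS (n L : nat) (c : config n) :
  nb_after L.+1 c = (\sum_(k | may_jump c k) nb_after L (jump c k))%N.
Proof.
rewrite /nb_after (big_tuple_cons _ _
  (fun v => valid_path c v && (run c v == final_config n) : nat)) [RHS]big_mkcond /=.
by apply: eq_bigr => k _; case: (may_jump c k) => //=; rewrite big1.
Qed.

Lemma nb_beforeS (n m : nat) (c : config n) : valid c ->
  nb_before m.+1 c = (\sum_(k | valid (unjump c k)) nb_before m (unjump c k))%N.
Proof.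
move=> vc; rewrite /nb_before (big_tuple_rcons _ _ (fun v => valid_path (init_config n) v
  && (run (init_config n) v == c) : nat)) [RHS]big_mkcond /=.
apply: eq_bigr => k _; rewrite big_mkcond /=.
have -> (b : bool) (S : nat) : (if b then S else 0%N) = (S * b)%N by case: b; lia.
rewrite big_distrl /=; apply: eq_bigr => u _.
rewrite -cats1 valid_path_cat run_cat /= andbT.
case vu: (valid_path (init_config n) u) => //=.
have vd := valid_run (valid_init n) vu.
set d := run _ u in vd *; rewrite mulnb; congr (nat_of_bool _).
apply/andP/andP => -[].
  by move=> mk /eqP e; rewrite -e jumpK eqxx.
move=> /eqP e vuc; rewrite e may_unjump // unjumpK //.
by have [_ /(_ k)] := validP _ vc; lia.
Qed.

(** The first jump of a path from c leads to a configuration [jump c k], so that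
    the counts satisfy the recursion of [bwd_weight]. *)
Lemma nb_afterE (R : realFieldType) (n L : nat) (c : config n) :
  valid c -> (\sum_k c k + L = \sum_k final_config n k)%N ->
  (nb_after L c)%:R = L`!%:R * bwd_weight R c.
Proof.
elim: L c => [|L IH] c vc cL.
  rewrite addn0 in cL.
  have -> : c = final_config n.
    by apply: leq_config_sum_eq => // k; apply: valid_le_final.
  rewrite bwd_weight_final mulr1 /nb_after (big_tuple0 _ (fun v =>
    valid_path (final_config n) v && (run (final_config n) v == final_config n) : nat)).
  by rewrite /= eqxx.
rewrite nb_afterS natr_sum factS natrM [_%:R * _]mulrC -mulrA -(bwd_weight_rec R vc cL).
rewrite mulr_sumr; apply: eq_bigr => k mk; apply: IH; first exact: valid_jump.
by rewrite sum_jump addSnnS.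
Qed.

(** The last jump of a path to c leads from a configuration [unjump c k], so that
    the counts satisfy the recursion of [fwd_weight]. *)
Lemma nb_beforeE (R : realFieldType) (n m : nat) (c : config n) :
  valid c -> (\sum_k c k = \sum_k init_config n k + m)%N ->
  (nb_before m c)%:R = m`!%:R * fwd_weight R c.
Proof.
elim: m c => [|m IH] c vc cm.
  rewrite addn0 in cm.
  have <- : init_config n = c.
    by apply: leq_config_sum_eq => // k; apply: valid_ge_init.
  rewrite fwd_weight_init mulr1 /nb_before (big_tuple0 _ (fun v =>
    valid_path (init_config n) v && (run (init_config n) v == init_config n) : nat)).
  by rewrite /= eqxx.
rewrite nb_beforeS // natr_sum factS natrM [_%:R * _]mulrC -mulrA -(fwd_weight_rec R vc cm).
rewrite mulr_sumr; apply: eq_bigr => k vk; apply: IH => //.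
have := sum_jump (unjump c k) k; rewrite unjumpK; first by move=> ?; lia.
by have [_ /(_ k)] := validP _ vc; lia.
Qed.

Definition visits (n m : nat) (c : config n) : nat :=
  \sum_(s in jump_sequences n) (config_at s m == c).

Definition transits (n m : nat) (c c' : config n) : nat :=
  \sum_(s in jump_sequences n) ((config_at s m == c) && (config_at s m.+1 == c')).

Lemma visitsE (n m L : nat) (c : config n) : (n ^ 2 = m + L)%N ->
  visits m c = (nb_before m c * nb_after L c)%N.
Proof.
move=> e; rewrite /visits big_mkcond /=.
rewrite (eq_bigr (fun s : instructions n => (valid_path (init_config n) s &&
   (run (init_config n) s == final_config n)) && (run (init_config n) (take m s) == c) : nat));
  last by move=> s _; rewrite inE jump_sequenceE; case: ifP.
rewrite (big_tuple_cat _ (fun s => (valid_path (init_config n) s &&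
   (run (init_config n) s == final_config n)) && (run (init_config n) (take m s) == c) : nat) e).
rewrite big_distrl /=; apply: eq_bigr => u _; rewrite big_distrr /=; apply: eq_bigr => v _.
rewrite take_size_cat ?size_tuple // valid_path_cat run_cat mulnb; congr (nat_of_bool _).
by case: (run (init_config n) u =P c) => [->|_]; rewrite ?andbT ?andbF // -andbA.
Qed.

Lemma transitsE (n m L : nat) (c : config n) (k : 'I_n) :
  (n ^ 2 = m + L.+1)%N -> may_jump c k ->
  transits m c (jump c k) = (nb_before m c * nb_after L (jump c k))%N.
Proof.
move=> e mk; rewrite /transits big_mkcond /=.
pose F (s : seq 'I_n) : nat := [&& valid_path (init_config n) s,
   run (init_config n) s == final_config n,
   run (init_config n) (take m s) == c & run (init_config n) (take m.+1 s) == jump c k].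
rewrite (eq_bigr (fun s : instructions n => F s)); last first.
  by move=> s _; rewrite inE jump_sequenceE /F andbA; case: ifP.
rewrite (big_tuple_cat _ F e) big_distrl /=; apply: eq_bigr => u _.
rewrite (big_tuple_cons _ _ (fun v => F (u ++ v))) big_distrr /=.
rewrite (bigD1 k) //= [X in (_ + X)%N]big1 ?addn0 => [|k' k'k].
  apply: eq_bigr => v _; rewrite /F take_size_cat ?size_tuple // -cat_rcons.
  rewrite take_size_cat ?size_rcons ?size_tuple // cat_rcons valid_path_cat run_cat /=.
  rewrite -cats1 run_cat /= mulnb; congr (nat_of_bool _).
  case: (run (init_config n) u =P c) => [->|_]; last by rewrite !andbF.
  by rewrite mk eqxx /= !andbT -andbA.
apply: big1 => v _; rewrite /F take_size_cat ?size_tuple // -cat_rcons.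
rewrite take_size_cat ?size_rcons ?size_tuple // -cats1 [run _ (u ++ [:: k'])]run_cat /=.
case: (run (init_config n) u =P c) => [->|_]; last by rewrite !andbF.
suff /negPf -> : jump c k' != jump c k by rewrite !andbF.
apply/eqP => /ffunP/(_ k'); rewrite !jumpE eqxx (negPf k'k); lia.
Qed.

(** The weights of c and of [jump c k] contribute the same Vandermonde products on
    both sides, and these cancel. What remains depends on the configuration only
    through the position from which the particle jumps. *)
Lemma visits_sq (R : realFieldType) (n m : nat) (c : config n) (k : 'I_n) :
  valid c -> may_jump c k -> (\sum_k c k = \sum_k init_config n k + m)%N ->
  (m < n ^ 2)%N ->
  (transits m c (jump c k))%:R ^+ 2 * (m.+1%:R * (n ^ 2 - m)%:R) =
  (visits m c)%:R * (visits m.+1 (jump c k))%:R * ((c k)%:R * (2 * n - c k)%:R) :> R.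
Proof.
move=> vc mk cm mN; have vj := valid_jump vc mk.
set L := (n ^ 2 - m.+1)%N.
have e1 : (n ^ 2 = m + L.+1)%N by rewrite /L; lia.
have e2 : (n ^ 2 = m.+1 + L)%N by rewrite /L; lia.
have fin : (\sum_k final_config n k = \sum_k init_config n k + n ^ 2)%N.
  have -> : (n ^ 2 = \sum_(k < n) n)%N by rewrite sum_nat_const card_ord.
  by rewrite -big_split; apply: eq_bigr => k' _; rewrite !ffunE addnC.
have [ck _] := may_jumpP _ _ mk.
have c0 : (0 < c k)%N by have [_ /(_ k)] := validP _ vc; lia.
rewrite (transitsE e1) // (visitsE _ e1) (visitsE _ e2) !natrM.
rewrite (nb_beforeE R vc cm) (nb_afterE R (L := L.+1) vc); last by rewrite fin; lia.
rewrite (nb_afterE R (L := L) vj) ?(nb_beforeE R (m := m.+1) vj); first last.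
- by rewrite sum_jump fin; lia.
- by rewrite sum_jump; lia.
rewrite bwd_weight_jump //.
have := @fwd_weight_unjump R n (jump c k) k; rewrite jumpK jumpE eqxx => -> //.
rewrite /fwd_weight /bwd_weight !factS !natrM.
have -> : (n ^ 2 - m = L.+1)%N by lia.
have hP : \prod_k0 ((jump c k k0).-1)`!%:R != 0 :> R by rewrite gt_eqF ?prod_fact_gt0.
have hQ : \prod_k0 ((2 * n - c k0)`!)%:R != 0 :> R by rewrite gt_eqF ?prod_fact_gt0.
rewrite [(c k).+1.-1]/=; move: (\prod_k0 _) hP (\prod_k0 _) hQ => P hP Q hQ.
by field; rewrite hP hQ.
Qed.

(** * Growth of the mean of a weighted statistic *)

Lemma card_jump_sequences_gt0 (n : nat) : (0 < #|jump_sequences n|)%N.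
Proof.
have h : visits 0 (init_config n) = #|jump_sequences n|.
  rewrite -sum1_card; apply: eq_bigr => s _.
  by rewrite /config_at take0 eqxx.
rewrite -h (visitsE _ (esym (add0n _))) -(ltr0n rat) natrM.
rewrite (nb_beforeE rat (valid_init n)) ?addn0 // (nb_afterE rat (valid_init n)).
  by apply: mulr_gt0; apply: mulr_gt0; rewrite ?ltr0n ?fact_gt0 ?fwd_weight_gt0 ?bwd_weight_gt0 ?valid_init.
have -> : (n ^ 2 = \sum_(k < n) n)%N by rewrite sum_nat_const card_ord.
by rewrite -big_split; apply: eq_bigr => k' _; rewrite !ffunE addnC.
Qed.

Lemma sum_fiber (R : numDomainType) (I : finType) (T : eqType) (O : {set I})
    (g : I -> T) (h : T -> R) :
  \sum_(s in O) h (g s) =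
  \sum_(t <- undup [seq g s | s in O]) (\sum_(s in O) (g s == t))%:R * h t.
Proof.
under [RHS]eq_bigr do rewrite natr_sum mulr_suml.
rewrite exchange_big /=; apply: eq_bigr => s sO.
rewrite (bigD1_seq (g s)) ?undup_uniq //=; last first.
  by rewrite mem_undup; apply/fintype.imageP; exists s.
by rewrite eqxx mul1r big1 ?addr0 // => t /negPf ts; rewrite eq_sym ts mul0r.
Qed.

(** Since f is injective where P holds, no fibre of g is counted twice. *)
Lemma sum_fiber_le (R : numDomainType) (I : finType) (T U : eqType) (O : {set I})
    (g : I -> T) (h : T -> R) (r : seq U) (P : pred U) (f : U -> T) :
  uniq r -> {in r &, forall i j, P i -> P j -> f i = f j -> i = j} ->
  (forall t, 0 <= h t) ->
  \sum_(i <- r | P i) (\sum_(s in O) (g s == f i))%:R * h (f i) <=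
  \sum_(s in O) h (g s).
Proof.
move=> ur inj h0; under eq_bigr do rewrite natr_sum mulr_suml.
rewrite exchange_big /=; apply: ler_sum => s sO.
case: (boolP (has (fun i => P i && (f i == g s)) r)) => [/hasP[i ir /andP[Pi /eqP fi]]|/hasPn nr].
  rewrite big_mkcond (bigD1_seq i) //= Pi fi eqxx mul1r big_seq_cond big1 ?addr0 //.
  move=> j /andP[jr ji]; case: ifP => // Pj; case: eqP => [e|_]; last by rewrite mul0r.
  by case/negP: ji; apply/eqP/inj => //; rewrite fi e.
rewrite big_seq_cond big1 // => i /andP[ir Pi].
by have := nr _ ir; rewrite Pi /= eq_sym => /negPf ->; rewrite mul0r.
Qed.

Lemma jump_sequence_step (n m : nat) (s : instructions n) :
  s \in jump_sequences n -> (m < n ^ 2)%N ->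
  let c := config_at s m in
  [/\ valid c, (\sum_k c k = \sum_k init_config n k + m)%N &
    exists2 k, may_jump c k & config_at s m.+1 = jump c k].
Proof.
rewrite inE jump_sequenceE => /andP[vs _] mN /=.
have sz : size (take m s) = m by rewrite size_takel // size_tuple ltnW.
move: (vs); rewrite -{1}(cat_take_drop m s) valid_path_cat => /andP[vt _].
split; first exact: (valid_run (valid_init n) vt).
  by rewrite [config_at s m]/(run _ _) sum_run sz.
pose k := tnth s (Ordinal mN).
have kE : nth k s m = k by rewrite {2}/k (tnth_nth k).
exists k.
  by have := valid_pathP _ k _ vs; rewrite size_tuple => /(_ _ mN); rewrite kE.
by rewrite /config_at (take_nth k) ?size_tuple // -cats1 foldl_cat /= kE.
Qed.

(** A statistic that moves by one step in a fixed direction, always through a jump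
    whose starting position is determined by the level: n + j or n - j for a move
    between j and j + 1. In both cases the position p satisfies
    p (2n - p) = n^2 - j^2, the factor of [visits_sq]. *)
Definition boundary_stat (n : nat) (up right : bool) (Y : config n -> nat) : Prop :=
  forall (c : config n) (k : 'I_n), valid c -> may_jump c k ->
  Y (jump c k) = Y c \/
  exists2 j, (j < n)%N &
    [/\ Y c = (if up then j else j.+1), Y (jump c k) = (if up then j.+1 else j)
      & c k = (if right then n + j else n - j)%N].

Definition mean (R : realType) (n : nat) (f : instructions n -> R) : R :=
  (\sum_(s in jump_sequences n) f s) / #|jump_sequences n|%:R.

Definition stat_mean (R : realType) (n : nat) (Y : config n -> nat) (w : nat -> R)
    (m : nat) : R :=
  mean (fun s => w (Y (config_at s m))).

Lemma norm_le_sq (R : realType) (x y : R) : 0 <= y -> x ^+ 2 <= y ^+ 2 -> `|x| <= y.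
Proof.
by move=> y0 xy; rewrite -(ger0_norm y0) -!sqrtr_sqr ler_sqrt // sqr_ge0.
Qed.

(** For a transition (c, c') that changes Y, [visits_sq] bounds its count times
    |w(Y c') - w(Y c)| by K / sqrt ((m+1)(n^2-m)) times the geometric mean of
    the contributions of c and c' to the two means. The level determines the
    starting position of the jump, hence the particle, so that each c and each c'
    occurs in at most one such transition, and the Cauchy-Schwarz inequality
    applies. *)
Lemma mean_step (R : realType) (n : nat) (up right : bool) (Y : config n -> nat)
    (w : nat -> R) (K : R) (m : nat) :
  boundary_stat up right Y -> (forall j, 0 < w j) -> 0 <= K ->
  (forall j, (j < n)%N ->
     (w j.+1 - w j) ^+ 2 * (n%:R ^+ 2 - j%:R ^+ 2) <= K ^+ 2 * (w j * w j.+1)) ->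
  (m < n ^ 2)%N ->
  `|stat_mean Y w m.+1 - stat_mean Y w m| <=
    K / Num.sqrt (m.+1%:R * (n ^ 2 - m)%:R) *
    Num.sqrt (stat_mean Y w m * stat_mean Y w m.+1).
Proof.
move=> hY w0 K0 hw mN.
set O := jump_sequences n; pose D := m.+1%:R * (n ^ 2 - m)%:R : R.
have D0 : 0 < D by rewrite mulr_gt0 ?ltr0n // subn_gt0.
pose ka := K / Num.sqrt D.
have ka0 : 0 <= ka by rewrite divr_ge0 ?sqrtr_ge0.
have ka2 : ka ^+ 2 = K ^+ 2 / D by rewrite expr_div_n sqr_sqrtr // ltW.
pose S i := \sum_(s in O) w (Y (config_at s i)).
have cO : 0 < #|O|%:R :> R by rewrite ltr0n card_jump_sequences_gt0.
have S0 i : 0 < S i.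
  have /card_gt0P[s0 s0O] := card_jump_sequences_gt0 n.
  rewrite /S (bigD1 s0) //=; apply: ltr_pwDl => //.
  by apply: sumr_ge0 => s _; apply: ltW.
pose g (s : instructions n) := (config_at s m, config_at s m.+1).
pose r := undup [seq g s | s in O].
pose P (i : config n * config n) := Y i.2 != Y i.1.
have rP i : i \in r -> [/\ valid i.1, (\sum_k i.1 k = \sum_k init_config n k + m)%N &
    exists2 k, may_jump i.1 k & i.2 = jump i.1 k].
  by rewrite mem_undup => /fintype.imageP[s sO ->]; apply: jump_sequence_step.
(* AM-GM with a free ratio la; optimizing la at the end gives the geometric mean. *)
have bound la : 0 < la -> `|S m.+1 - S m| <= ka / 2 * (la * S m + S m.+1 / la).
  move=> la0.
  have -> : S m.+1 - S m = \sum_(i <- r | P i)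
      (transits m i.1 i.2)%:R * (w (Y i.2) - w (Y i.1)).
    rewrite -sumrB (sum_fiber O g (fun i => w (Y i.2) - w (Y i.1))) [RHS]big_mkcond.
    apply: eq_bigr => i _; rewrite /P; case: eqP => /= [->|_].
      by rewrite subrr mulr0.
    by congr (_%:R * _); apply: eq_bigr => s _.
  apply: (le_trans (ler_norm_sum _ _ _)).
  apply: (@le_trans _ _ (\sum_(i <- r | P i) ka / 2 *
     (la * ((visits m i.1)%:R * w (Y i.1)) + (visits m.+1 i.2)%:R * w (Y i.2) / la))).
    rewrite big_seq_cond [X in _ <= X]big_seq_cond.
    apply: ler_sum => i /andP[ir Pi]; have [vc cm [k mk e]] := rP _ ir.
    have := visits_sq R vc mk cm mN; rewrite -e -/D.
    set T := (transits _ _ _)%:R; set V := (visits _ _)%:R; set V' := (visits _ _)%:R.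
    move=> sq.
    have hd : (w (Y i.2) - w (Y i.1)) ^+ 2 * ((i.1 k)%:R * (2 * n - i.1 k)%:R)
       <= K ^+ 2 * (w (Y i.1) * w (Y i.2)).
      case: (hY _ _ vc mk) => [e'|[j jn [Y1 Y2 ck]]].
        by move: Pi; rewrite /P e e' eqxx.
      have -> : (i.1 k)%:R * (2 * n - i.1 k)%:R = n%:R ^+ 2 - j%:R ^+ 2 :> R.
        rewrite ck; case: right {hY ck}; last first.
          have -> : (2 * n - (n - j) = n + j)%N by clear -jn; lia.
          by rewrite natrB ?(ltnW jn) // natrD; ring.
        have -> : (2 * n - (n + j) = n - j)%N by clear -jn; lia.
        by rewrite natrB ?(ltnW jn) // natrD; ring.
      rewrite e Y1 Y2; have := hw _ jn; case: up {hY Y1 Y2} => //.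
      by rewrite -sqrrN opprB [w j * _]mulrC.
    have V0 : 0 <= V * w (Y i.1) by rewrite mulr_ge0 ?ler0n // ltW.
    have V'0 : 0 <= V' * w (Y i.2) by rewrite mulr_ge0 ?ler0n // ltW.
    apply: norm_le_sq.
      by rewrite mulr_ge0 ?divr_ge0 // addr_ge0 // ?divr_ge0 ?mulr_ge0 // ltW.
    set a := V * _ in V0 *; set b := V' * _ in V'0 *.
    have -> : (T * (w (Y i.2) - w (Y i.1))) ^+ 2 =
       V * V' * ((w (Y i.2) - w (Y i.1)) ^+ 2 * ((i.1 k)%:R * (2 * n - i.1 k)%:R)) / D.
      apply: (mulIf (lt0r_neq0 D0)); rewrite mulfVK ?lt0r_neq0 //.
      by rewrite exprMn mulrAC sq; ring.
    apply: (@le_trans _ _ (ka ^+ 2 * (a * b))).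
      rewrite ka2 [X in _ <= X]mulrAC ler_pM2r ?invr_gt0 //.
      have VV : 0 <= V * V' by rewrite mulr_ge0 // ler0n.
      by have := ler_wpM2l VV hd; rewrite /a /b; nra.
    have -> : (ka / 2 * (la * a + b / la)) ^+ 2 =
       ka ^+ 2 * (a * b) + ka ^+ 2 * ((la * a - b / la) / 2) ^+ 2.
      by field; rewrite lt0r_neq0.
    by rewrite lerDl mulr_ge0 ?sqr_ge0.
  rewrite -mulr_sumr ler_wpM2l ?divr_ge0 // big_split /= lerD //.
    rewrite -mulr_sumr ler_wpM2l ?(ltW la0) //.
    apply: (@sum_fiber_le _ _ _ _ O (fun s => config_at s m) (fun c => w (Y c)) r P
       (fun i => i.1)); rewrite ?undup_uniq //; last by move=> c; apply: ltW.
    move=> i i' ir i'r Pi Pi' e1; have [vc _ [k mk e]] := rP _ ir.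
    have [_ _ [k' mk' e']] := rP _ i'r.
    have kk : k = k'.
      move: mk' e'; rewrite -e1 => mk' e'; apply: (valid_inj vc).
      case: (hY _ _ vc mk) => [f|[j jn [Y1 Y2 ->]]]; first by move: Pi; rewrite /P e f eqxx.
      case: (hY _ _ vc mk') => [f|[j' jn' [Y1' Y2' ->]]].
        by move: Pi'; rewrite /P e' -e1 f eqxx.
      by have -> : j = j'; first by move: Y1'; rewrite Y1; case: up {hY Y1 Y2 Y2'} => // -[].
    by move: e1 e e'; rewrite -kk; case: i {ir Pi vc mk} i' {i'r Pi' mk'} => [? ?] [? ?] /= -> -> ->.
  rewrite -mulr_suml ler_wpM2r ?invr_ge0 ?(ltW la0) //.
  apply: (@sum_fiber_le _ _ _ _ O (fun s => config_at s m.+1) (fun c => w (Y c)) r P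
     (fun i => i.2)); rewrite ?undup_uniq //; last by move=> c; apply: ltW.
  move=> i i' ir i'r Pi Pi' e2; have [vc _ [k mk e]] := rP _ ir.
  have [vc' _ [k' mk' e']] := rP _ i'r.
  have vj : valid i.2 by rewrite e; apply: valid_jump.
  have kk : k = k'.
    apply: (valid_inj vj); rewrite {2}e2 e e' !jumpE !eqxx; congr _.+1.
    case: (hY _ _ vc mk) => [f|[j jn [Y1 Y2 ->]]]; first by move: Pi; rewrite /P e f eqxx.
    case: (hY _ _ vc' mk') => [f|[j' jn' [Y1' Y2' ->]]].
      by move: Pi'; rewrite /P e' f eqxx.
    have -> : j = j'; last by [].
    by move: Y2'; rewrite -e' -e2 e Y2; case: up {hY Y1 Y2 Y1'} => // -[].
  have : i.1 = i'.1 by rewrite -(jumpK i.1 k) -(jumpK i'.1 k') -e -e' e2 kk.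
  by move: e2; case: i {ir Pi vc mk e vj} i' {i'r Pi' vc' mk' e'} => [? ?] [? ?] /= -> ->.
(* This ratio makes the two terms of the AM-GM bound equal. *)
pose la := Num.sqrt (S m.+1 / S m).
have la0 : 0 < la by rewrite sqrtr_gt0 divr_gt0.
have Sm := sqr_sqrtr (ltW (S0 m)); have Sm' := sqr_sqrtr (ltW (S0 m.+1)).
have s0 : 0 < Num.sqrt (S m) by rewrite sqrtr_gt0.
have s0' : 0 < Num.sqrt (S m.+1) by rewrite sqrtr_gt0.
have := bound _ la0.
have -> : ka / 2 * (la * S m + S m.+1 / la) = ka * Num.sqrt (S m * S m.+1).
  rewrite /la sqrtrM ?(ltW (S0 _)) // sqrtrV ?(ltW (S0 _)) // sqrtrM ?(ltW (S0 _)) //.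
  by rewrite -{2}Sm -{2}Sm'; field; rewrite !lt0r_neq0.
move=> h; have -> : Num.sqrt (stat_mean Y w m * stat_mean Y w m.+1) = Num.sqrt (S m * S m.+1) / #|O|%:R.
  rewrite /stat_mean /mean -/(S m) -/(S m.+1) mulrACA -invfM -expr2.
  by rewrite sqrtrM ?mulr_ge0 ?(ltW (S0 _)) // sqrtrV ?sqr_ge0 // sqrtr_sqr ger0_norm // ltW.
rewrite /stat_mean /mean -/(S m) -/(S m.+1) -/O -mulrBl normrM [`|_^-1|]ger0_norm; last first.
  by rewrite invr_ge0 ltW.
by rewrite mulrA ler_wpM2r // invr_ge0 ltW.
Qed.

(** * Trigonometric scales for time and for the statistics *)

Lemma ler_cos_pi (R : realType) (x y : R) :
  0 <= x -> x <= y -> y <= pi -> cos y <= cos x.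
Proof.
move=> x0; rewrite le_eqVlt => /orP[/eqP -> //|xy] ypi.
apply/ltW; rewrite ltr_cos // in_itv /=; lra.
Qed.

Lemma cos_le_inv (R : realType) (x y : R) :
  0 <= x <= pi -> 0 <= y <= pi -> cos y <= cos x -> x <= y.
Proof.
by move=> hx hy h; rewrite leNgt -ltr_cos ?in_itv //= -leNgt.
Qed.

Lemma sin_sub_bounds (R : realType) (u v : R) : 0 <= u -> u <= v -> v <= pi / 2 ->
  (v - u) * cos v <= sin v - sin u <= (v - u) * cos u.
Proof.
move=> u0 uv vpi; have pi0 := pi_ge0 R.
have cs : {within `[u, v], continuous (@sin R)}.
  exact/continuous_subspaceT/continuous_sin.
have [x] := MVT_segment uv (fun x _ => is_derive_sin x) cs.
rewrite in_itv /= => /andP[ux xv] ->; rewrite [cos x * _]mulrC.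
apply/andP; split; rewrite ler_wpM2l ?subr_ge0 ?ler_cos_pi //; lra.
Qed.

Lemma cos_sub_bound (R : realType) (p q b : R) : 0 <= p -> p <= q -> q <= pi ->
  0 <= b -> (forall c, cos q <= c <= cos p -> (1 - c ^+ 2) <= b ^+ 2) ->
  cos p - cos q <= (q - p) * b.
Proof.
move=> p0 pq qpi b0 hb.
have cs : {within `[p, q], continuous (@cos R)}.
  exact/continuous_subspaceT/continuous_cos.
have [x] := MVT_segment pq (fun x _ => is_derive_cos x) cs.
rewrite in_itv /= => /andP[px xq] e.
have -> : cos p - cos q = (q - p) * sin x by rewrite -opprB e; ring.
rewrite ler_wpM2l ?subr_ge0 //.
rewrite -(ger0_norm b0) (le_trans (ler_norm _)) //.
rewrite -!sqrtr_sqr ler_wsqrtr // sin2cos2 hb // !ler_cos_pi //; lra.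
Qed.

Lemma cos_sub_le (R : realType) (p q : R) : 0 <= p -> p <= q -> q <= pi ->
  cos p - cos q <= q - p.
Proof.
move=> p0 pq qpi; rewrite -[leRHS]mulr1; apply: cos_sub_bound => // c _.
by rewrite expr1n gerBl sqr_ge0.
Qed.

Lemma sinh_ge (R : realType) (y : R) : 0 <= y -> 2 * y <= expR y - expR (- y).
Proof.
move=> y0; pose f (x : R) := expR x - expR (- x) - 2 * x.
have df (x : R) : is_derive x 1 f (expR x + expR (- x) - 2).
  rewrite /f; apply: is_derive_eq; rewrite !scaler1; lra.
have cf : {within `[0, y], continuous f}.
  apply: derivable_within_continuous => x _; exact: ex_derive.
have [x _] := MVT_segment y0 (fun x _ => df x) cf.
rewrite subr0 {1 2}/f oppr0 subrr mulr0 !subr0 -subr_ge0 => ->.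
rewrite mulr_ge0 // expRN.
have := expR_gt0 x; move: (expR x) => e e0.
have -> : e + e^-1 - 2 = (e - 1) ^+ 2 / e by field; rewrite lt0r_neq0.
by rewrite divr_ge0 ?sqr_ge0 // ltW.
Qed.

(** With b / a = exp (2 y) the hypothesis says 2 sinh y <= ka, and sinh y >= y. *)
Lemma ratio_le_expR (R : realType) (a b ka : R) : 0 < a -> 0 < b -> 0 <= ka ->
  `|b - a| <= ka * Num.sqrt (a * b) -> b <= a * expR ka.
Proof.
move=> a0 b0 k0 h; set p := Num.sqrt a; set q := Num.sqrt b.
have p0 : 0 < p by rewrite sqrtr_gt0.
have q0 : 0 < q by rewrite sqrtr_gt0.
have pE : a = p ^+ 2 by rewrite sqr_sqrtr // ltW.
have qE : b = q ^+ 2 by rewrite sqr_sqrtr // ltW.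
have {}h : q ^+ 2 - p ^+ 2 <= ka * (p * q).
  by rewrite -pE -qE -sqrtrM ?(ltW a0) //; apply: (le_trans (ler_norm _) h).
pose y := ln (q / p).
have yE : expR y = q / p by rewrite lnK // posrE divr_gt0.
case: (lerP y 0) => y0.
  have : q / p <= 1 by rewrite -yE -expR0 ler_expR.
  rewrite ler_pdivrMr // mul1r => qp.
  have : 1 <= expR ka by rewrite -expR0 ler_expR.
  rewrite pE qE; nra.
have := sinh_ge (ltW y0); rewrite expRN yE => hy.
have {}hy : 2 * y <= ka.
  apply: (le_trans hy).
  have -> : q / p - (q / p)^-1 = (q ^+ 2 - p ^+ 2) / (p * q).
    by field; rewrite !lt0r_neq0.
  by rewrite ler_pdivrMr ?mulr_gt0.
have : expR (2 * y) <= expR ka by rewrite ler_expR.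
have -> : expR (2 * y) = (q / p) ^+ 2 by rewrite -yE -expRM_natl.
rewrite expr_div_n ler_pdivrMr ?exprn_gt0 // pE qE mulrC; exact.
Qed.

(** The angle th in [0, pi] with m / N = (1 - cos th) / 2. *)
Definition time_angle (R : realType) (N m : nat) : R :=
  acos (1 - 2 * m%:R / N%:R).

Lemma time_arg_itv (R : realType) (N m : nat) : (m <= N)%N ->
  (-1 : R) <= 1 - 2 * (m%:R : R) / N%:R <= 1.
Proof.
move=> mN; have h : 0 <= (m%:R : R) / N%:R <= 1.
  case: (posnP N) => [->|N0]; first by rewrite invr0 mulr0 lexx ler01.
  by rewrite divr_ge0 //= ler_pdivrMr ?ltr0n // mul1r ler_nat.
by lra.
Qed.

Lemma cos_time_angle (R : realType) (N m : nat) : (m <= N)%N ->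
  cos (time_angle R N m) = 1 - 2 * m%:R / N%:R.
Proof. by move=> mN; rewrite acosK // in_itv /= time_arg_itv. Qed.

Lemma time_angle_itv (R : realType) (N m : nat) : (m <= N)%N ->
  0 <= time_angle R N m <= pi.
Proof. by move=> mN; rewrite acos_ge0 ?acos_lepi ?time_arg_itv. Qed.

Lemma time_angle0 (R : realType) (N : nat) : time_angle R N 0 = 0.
Proof. by rewrite /time_angle mulr0 mul0r subr0 acos1. Qed.

(** Since (1 - c)(1 + c) <= 4 (m+1)(N-m) / N^2 for c between the two cosines, the
    derivative of cos, in absolute value, is at most twice the square root of
    (m+1)(N-m), divided by N, over the whole step. *)
Lemma time_angle_step (R : realType) (N m : nat) : (m < N)%N ->
  1 / Num.sqrt (m.+1%:R * (N - m)%:R) <= time_angle R N m.+1 - time_angle R N m.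
Proof.
move=> mN; have N0 : 0 < N%:R :> R by rewrite ltr0n; lia.
have /andP[p0 ppi] := time_angle_itv R (ltnW mN).
have /andP[q0 qpi] := time_angle_itv R mN.
have D0 : 0 < m.+1%:R * (N - m)%:R :> R by rewrite mulr_gt0 ?ltr0n ?subn_gt0.
have cE : cos (time_angle R N m) - cos (time_angle R N m.+1) = 2 / N%:R.
  rewrite !cos_time_angle // 1?ltnW // -natr1; field; exact: lt0r_neq0.
have pq : time_angle R N m <= time_angle R N m.+1.
  apply: cos_le_inv; rewrite ?p0 ?q0 // -subr_ge0 cE divr_ge0 // ltW.
set S := Num.sqrt _; have S0 : 0 < S by rewrite sqrtr_gt0.
have S2 : S ^+ 2 = m.+1%:R * (N - m)%:R by rewrite sqr_sqrtr // ltW.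
have : cos (time_angle R N m) - cos (time_angle R N m.+1) <=
    (time_angle R N m.+1 - time_angle R N m) * (2 * S / N%:R).
  apply: cos_sub_bound => //; first by rewrite divr_ge0 ?mulr_ge0 // ltW.
  move=> c; rewrite !cos_time_angle // 1?ltnW // => /andP[c1 c2].
  have -> : (2 * S / N%:R) ^+ 2 = (2 * m.+1%:R / N%:R) * (2 - 2 * m%:R / N%:R).
    rewrite expr_div_n exprMn S2 natrB 1?ltnW //; field; exact: lt0r_neq0.
  have -> : 1 - c ^+ 2 = (1 - c) * (1 + c) by ring.
  have /andP[] := time_arg_itv R (ltnW mN); have /andP[] := time_arg_itv R mN.
  by move=> *; apply: ler_pM; lra.
rewrite cE => h; rewrite ler_pdivrMr //.
have : 2 / N%:R * (N%:R / 2) <= (time_angle R N m.+1 - time_angle R N m) * (2 * S / N%:R) * (N%:R / 2).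
  by rewrite ler_wpM2r // divr_ge0 // ltW.
have -> : 2 / N%:R * (N%:R / 2) = 1 :> R by field; rewrite lt0r_neq0.
suff -> : (time_angle R N m.+1 - time_angle R N m) * (2 * S / N%:R) * (N%:R / 2) =
  (time_angle R N m.+1 - time_angle R N m) * S by [].
by field; rewrite lt0r_neq0.
Qed.

(** A Riemann sum for asin (j / n), chosen so that the bounds on the weights below
    hold exactly and not only up to lower order terms. *)
Definition space_angle (R : realType) (n j : nat) : R :=
  \sum_(i < j) (Num.sqrt (n%:R ^+ 2 - i%:R ^+ 2))^-1.

(** A discrete exponential of s times [space_angle]; the product form makes
    [growth_weight_step] hold exactly with K = s, for the weight and for its inverse. *)
Definition growth_weight (R : realType) (n : nat) (s : R) (j : nat) : R :=
  \prod_(i < j) (1 + s / Num.sqrt (n%:R ^+ 2 - i%:R ^+ 2)).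

Lemma asin_ratio_itv (R : realType) (n j : nat) : (j <= n)%N ->
  0 <= asin ((j%:R : R) / n%:R) <= pi / 2.
Proof.
move=> jn; have h : 0 <= (j%:R : R) / n%:R <= 1.
  case: (posnP n) => [->|n0]; first by rewrite invr0 mulr0 lexx ler01.
  by rewrite divr_ge0 //= ler_pdivrMr ?ltr0n // mul1r ler_nat.
have h' : -1 <= (j%:R : R) / n%:R <= 1 by lra.
rewrite asin_lepi2 // andbT leNgt; apply/negP => lt0.
have := asin_geNpi2 h'; have pi0 := pi_ge0 R => ge.
have : sin (asin (j%:R / n%:R)) < sin 0 :> R by rewrite ltr_sin // in_itv /=; lra.
by rewrite asinK ?in_itv //= sin0; lra.
Qed.

Lemma sin_asin_ratio (R : realType) (n j : nat) : (j <= n)%N ->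
  sin (asin (j%:R / n%:R)) = j%:R / n%:R :> R.
Proof.
move=> jn; rewrite asinK // in_itv /=.
case: (posnP n) => [->|n0]; first by rewrite invr0 mulr0; lra.
have : j%:R / n%:R <= 1 :> R by rewrite ler_pdivrMr ?ltr0n // mul1r ler_nat.
have : 0 <= j%:R / n%:R :> R by rewrite divr_ge0.
lra.
Qed.

Lemma cos_asin_ratio (R : realType) (n j : nat) : (j <= n)%N -> (0 < n)%N ->
  cos (asin (j%:R / n%:R)) = Num.sqrt (n%:R ^+ 2 - j%:R ^+ 2) / n%:R :> R.
Proof.
move=> jn n0; rewrite cos_asin; last first.
  have : j%:R / n%:R <= 1 :> R by rewrite ler_pdivrMr ?ltr0n // mul1r ler_nat.
  have : 0 <= j%:R / n%:R :> R by rewrite divr_ge0.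
  lra.
have n0' : 0 < n%:R :> R by rewrite ltr0n.
have -> : 1 - (j%:R / n%:R) ^+ 2 = (n%:R ^+ 2 - j%:R ^+ 2) / n%:R ^+ 2 :> R.
  by field; rewrite lt0r_neq0.
rewrite sqrtrM ?sqrtrV ?sqr_ge0 // ?sqrtr_sqr ?ger0_norm ?(ltW n0') //.
by rewrite subr_ge0 lerXn2r ?nnegrE // ler_nat.
Qed.

Lemma asin_ratio_le (R : realType) (n i j : nat) : (i <= j)%N -> (j <= n)%N ->
  asin (i%:R / n%:R) <= asin (j%:R / n%:R) :> R.
Proof.
move=> ij jn; have pi0 := pi_ge0 R.
have /andP[a0 api] := asin_ratio_itv R jn.
have /andP[b0 bpi] := asin_ratio_itv R (leq_trans ij jn).
rewrite leNgt -ltr_sin ?in_itv /= ?sin_asin_ratio // ?(leq_trans ij) //; last 2 first.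
- lra.
- lra.
by rewrite -leNgt ler_wpM2r ?invr_ge0 // ler_nat.
Qed.

Lemma asin_ratio_step (R : realType) (n j : nat) : (j < n)%N ->
  (Num.sqrt (n%:R ^+ 2 - j%:R ^+ 2))^-1 <=
  asin (j.+1%:R / n%:R) - asin (j%:R / n%:R) :> R.
Proof.
move=> jn; have n0 : (0 < n)%N by lia.
have n0' : 0 < n%:R :> R by rewrite ltr0n.
have /andP[a0 api] := asin_ratio_itv R jn.
have /andP[b0 bpi] := asin_ratio_itv R (ltnW jn).
have le := @asin_ratio_le R _ _ _ (leqnSn j) jn.
have /andP[_] := sin_sub_bounds b0 le api.
rewrite !sin_asin_ratio ?cos_asin_ratio // 1?ltnW //.
set S := Num.sqrt _; have S0 : 0 < S.
  by rewrite sqrtr_gt0 subr_gt0 ltrXn2r ?nnegrE // ltr_nat.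
set d := _ - asin _ => h.
rewrite -div1r ler_pdivrMr //.
move: h; rewrite -mulrBl -natrB // subSnn mulrA ler_pM2r ?invr_gt0 //.
Qed.

Lemma asin_ratio_step_le (R : realType) (n j : nat) : (0 < j)%N -> (j < n)%N ->
  asin (j%:R / n%:R) - asin (j.-1%:R / n%:R) <=
  (Num.sqrt (n%:R ^+ 2 - j%:R ^+ 2))^-1 :> R.
Proof.
case: j => // j _ jn; have n0 : (0 < n)%N by lia.
have n0' : 0 < n%:R :> R by rewrite ltr0n.
have jn' := ltnW jn; have jn'' := ltnW jn'.
have /andP[a0 api] := asin_ratio_itv R jn'.
have /andP[b0 bpi] := asin_ratio_itv R jn''.
have le := @asin_ratio_le R _ _ _ (leqnSn j) jn'.
have /andP[+ _] := sin_sub_bounds b0 le api.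
rewrite !sin_asin_ratio ?cos_asin_ratio //=.
set S := Num.sqrt _; have S0 : 0 < S.
  by rewrite sqrtr_gt0 subr_gt0 ltrXn2r ?nnegrE // ltr_nat.
set d := _ - asin _ => h.
rewrite -[leRHS]div1r ler_pdivlMr //.
by move: h; rewrite -mulrBl -natrB // subSnn mulrA ler_pM2r ?invr_gt0.
Qed.

Lemma space_angle_le (R : realType) (n j : nat) : (j <= n)%N ->
  space_angle R n j <= asin (j%:R / n%:R).
Proof.
elim: j => [|j IH] jn.
  by rewrite /space_angle big_ord0; have /andP[] := asin_ratio_itv R jn.
rewrite /space_angle big_ord_recr /=.
have := IH (ltnW jn); have := asin_ratio_step R jn; rewrite /space_angle; lra.
Qed.

(** Comparison with the integral, shifted by one index: at the last index j = n
    the integrand is infinite. *)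
Lemma space_angle_ge (R : realType) (n j : nat) : (j < n)%N ->
  asin (j%:R / n%:R) <= space_angle R n j.+1.
Proof.
elim: j => [|j IH] jn.
  rewrite mul0r -[X in asin X](@sin0 R) sinK; last first.
    by rewrite in_itv /=; have := pi_ge0 R; lra.
  by apply: sumr_ge0 => i _; rewrite invr_ge0 sqrtr_ge0.
rewrite /space_angle big_ord_recr /=.
have := IH (ltnW jn); have := asin_ratio_step_le R (ltn0Sn j) jn; rewrite /space_angle /=; lra.
Qed.

Lemma growth_weight_ge1 (R : realType) (n : nat) (s : R) (j : nat) : 0 <= s ->
  1 <= growth_weight n s j.
Proof.
move=> s0; rewrite /growth_weight; elim: j => [|j IH]; first by rewrite big_ord0.
by rewrite big_ord_recr /= mulr_ege1 // lerDl divr_ge0 ?sqrtr_ge0.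
Qed.

Lemma growth_weight_homo (R : realType) (n : nat) (s : R) (i j : nat) : 0 <= s ->
  (i <= j)%N -> growth_weight n s i <= growth_weight n s j.
Proof.
move=> s0; elim: j => [|j IH]; first by rewrite leqn0 => /eqP ->.
rewrite leq_eqVlt => /orP[/eqP -> //|ij]; apply: (le_trans (IH ij)).
rewrite /growth_weight [leRHS]big_ord_recr /=.
by rewrite ler_peMr ?lerDl ?divr_ge0 ?sqrtr_ge0 // (le_trans ler01) // growth_weight_ge1.
Qed.

Lemma growth_weight_le (R : realType) (n : nat) (s : R) (j : nat) : 0 <= s ->
  growth_weight n s j <= expR (s * space_angle R n j).
Proof.
move=> s0; rewrite mulr_sumr expR_sum; apply: ler_prod => i _.
by rewrite expR_ge1Dx andbT addr_ge0 // divr_ge0 ?sqrtr_ge0.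
Qed.

Lemma growth_weight_ge (R : realType) (n : nat) (s : R) (j : nat) :
  0 <= s -> (j <= n)%N ->
  expR (s * space_angle R n j / (1 + s / Num.sqrt n%:R)) <= growth_weight n s j.
Proof.
move=> s0 jn; rewrite mulr_sumr mulr_suml expR_sum; apply: ler_prod => i _.
rewrite expR_ge0 /=; set r := Num.sqrt _.
have n0 : 0 < n%:R :> R by rewrite ltr0n; have := ltn_ord i; lia.
have q0 : 0 < Num.sqrt n%:R :> R by rewrite sqrtr_gt0.
have rq : Num.sqrt n%:R <= r.
  apply: ler_wsqrtr; have := leq_trans (ltn_ord i) jn.
  rewrite -(ler_nat R) -natr1 => h.
  have : (0 : R) <= i%:R by [].
  nra.
have r0 : 0 < r by apply: lt_le_trans rq.
have u0 : 0 <= s / r by rewrite divr_ge0 // ltW.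
have uu : s / r <= s / Num.sqrt n%:R by rewrite ler_wpM2l // lef_pV2 ?posrE.
(* With u = s / r, this is 1 - v <= exp (- v) at v = u / (1 + u). *)
have v1 : (s / r) / (1 + s / Num.sqrt n%:R) <= s / r / (1 + s / r).
  by rewrite ler_wpM2l // lef_pV2 ?posrE; lra.
apply: (@le_trans _ _ (expR (s / r / (1 + s / r)))); first by rewrite ler_expR.
have := expR_ge1Dx (- (s / r / (1 + s / r))).
have -> : 1 - s / r / (1 + s / r) = (1 + s / r)^-1.
  by field; rewrite !lt0r_neq0 //; lra.
by rewrite expRN lef_pV2 ?posrE ?expR_gt0 //; lra.
Qed.

(** * The four boundary statistics *)

Lemma card_ord_lt (n k : nat) : (k <= n)%N -> #|[set i : 'I_n | (i < k)%N]%SET| = k.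
Proof.
move=> kn; rewrite -sum1_card; under eq_bigl => i do rewrite inE.
by rewrite (big_ord_narrow kn) sum1_card card_ord.
Qed.

Lemma mem_down_closed (n : nat) (U : {set 'I_n}) (k : 'I_n) :
  (forall i j : 'I_n, (i <= j)%N -> j \in U -> i \in U) ->
  (k \in U) = (k < #|U|)%N.
Proof.
move=> dc; apply/idP/idP => [kU|].
  rewrite -(card_ord_lt (ltn_ord k)); apply/subset_leq_card/fintype.subsetP => i.
  by rewrite inE ltnS => ik; apply: dc kU.
apply: contraTT => kU; rewrite -leqNgt -[leqRHS](card_ord_lt (ltnW (ltn_ord k))).
apply/subset_leq_card/fintype.subsetP => i iU; rewrite inE ltnNge.
by apply: contra kU => ki; apply: dc iU.
Qed.

Definition unmoved (n : nat) (c : config n) : {set 'I_n} :=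
  [set k : 'I_n | c k == init_config n k]%SET.

Definition unfinished (n : nat) (c : config n) : {set 'I_n} :=
  [set k : 'I_n | c k != final_config n k]%SET.

Lemma mem_unmoved (n : nat) (c : config n) (k : 'I_n) :
  valid c -> (k \in unmoved c) = (k < #|unmoved c|)%N.
Proof.
move=> vc; apply: mem_down_closed => i j ij; rewrite !inE !ffunE => /eqP cj.
by have := valid_gap vc ij; have := valid_ge_init i vc; rewrite ffunE; lia.
Qed.

Lemma mem_unfinished (n : nat) (c : config n) (k : 'I_n) :
  valid c -> (k \in unfinished c) = (k < #|unfinished c|)%N.
Proof.
move=> vc; apply: mem_down_closed => i j ij; rewrite !inE !ffunE; apply: contra => /eqP ci.
by have := valid_gap vc ij; have := valid_le_final j vc; rewrite ffunE; lia.
Qed.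

Lemma card_le_ord (n : nat) (U : {set 'I_n}) : (#|U| <= n)%N.
Proof. by rewrite -[leqRHS]card_ord max_card. Qed.

Definition stat_last (n : nat) (i : 'I_n) (c : config n) : nat := (c i - n)%N.
Definition stat_moved (n : nat) (c : config n) : nat := (n - #|unmoved c|)%N.
Definition stat_first (n : nat) (i : 'I_n) (c : config n) : nat := (n.+1 - c i)%N.
Definition stat_unfinished (n : nat) (c : config n) : nat := #|unfinished c|.

Lemma boundary_stat_last (n : nat) (i : 'I_n) : i.+1 = n ->
  boundary_stat true true (stat_last i).
Proof.
move=> iE c k vc /may_jumpP[ck _]; rewrite /stat_last jumpE.
case: eqP => [ik|_]; [right|by left]; subst k.
have := valid_ge_init i vc; rewrite ffunE => ci.
by exists (c i - n)%N; [lia|split; lia].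
Qed.

Lemma boundary_stat_first (n : nat) (i : 'I_n) : i = 0%N :> nat ->
  boundary_stat false false (stat_first i).
Proof.
move=> iE c k vc mk; have vj := valid_jump vc mk; rewrite /stat_first jumpE.
case: eqP => [ik|_]; [right|by left]; subst k.
have := valid_le_final i vj; rewrite jumpE eqxx ffunE iE => cn.
have := valid_ge_init i vc; rewrite ffunE iE => ci.
by exists (n - c i)%N; [lia|split; lia].
Qed.

(** The unmoved particles are the lowest ones, so that only the highest of them can
    start, and it starts from its initial position. *)
Lemma boundary_stat_moved (n : nat) : boundary_stat true false (@stat_moved n).
Proof.
move=> c k vc mk; have [ck cj] := may_jumpP _ _ mk.
have ge := valid_ge_init k vc; rewrite ffunE in ge.
rewrite /stat_moved; case: (boolP (k \in unmoved c)) => kU; last first.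
  left; congr (n - #|pred_of_set _|)%N; apply/finset.setP => j; move: kU; rewrite !inE jumpE.
  by case: (j =P k) => // -> /negPf kU; rewrite kU; apply/negbTE; move: kU; rewrite ffunE; lia.
have UE : unmoved (jump c k) = (unmoved c :\ k)%SET.
  apply/finset.setP => j; move: kU; rewrite !inE jumpE; case: (j =P k) => //= -> /eqP ->.
  by rewrite ffunE; lia.
have kc : c k = k.+1 by move: kU; rewrite inE ffunE => /eqP.
have cU : #|unmoved c| = k.+1.
  have := kU; rewrite mem_unmoved // => k1; apply/eqP; rewrite eqn_leq k1 andbT.
  case: (ltnP k.+1 n) => [kn|nk]; last by rewrite (leq_trans (card_le_ord _)).
  rewrite leqNgt; apply/negP => h.
  have : Ordinal kn \in unmoved c by rewrite mem_unmoved.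
  by rewrite inE ffunE /= => /eqP e; have := cj (Ordinal kn); rewrite e kc eqxx.
right; exists (n - k.+1)%N; first by have := ltn_ord k; lia.
have := cardsD1 k (unmoved c); rewrite -UE kU cU => cU'.
by have := ltn_ord k; move: cU'; rewrite add1n => -[<-] kn; split => //; lia.
Qed.

(** The unfinished particles are the lowest ones, so that only the highest of them
    can reach its final position. *)
Lemma boundary_stat_unfinished (n : nat) : boundary_stat false true (@stat_unfinished n).
Proof.
move=> c k vc mk; have [ck cj] := may_jumpP _ _ mk.
have vj := valid_jump vc mk.
have le := valid_le_final k vj; rewrite jumpE eqxx ffunE in le.
rewrite /stat_unfinished; have kU : k \in unfinished c by rewrite inE ffunE; lia.
case: (eqVneq (c k).+1 (n + k.+1)%N) => [e|ne]; last first.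
  left; congr #|pred_of_set _|; apply/finset.setP => j; move: kU; rewrite !inE jumpE.
  by case: (j =P k) => // -> ->; rewrite ffunE.
have UE : unfinished (jump c k) = (unfinished c :\ k)%SET.
  apply/finset.setP => j; rewrite !inE jumpE; case: (j =P k) => //= ->.
  by rewrite ffunE e eqxx.
have cU : #|unfinished c| = k.+1.
  have := kU; rewrite mem_unfinished // => k1; apply/eqP; rewrite eqn_leq k1 andbT.
  case: (ltnP k.+1 n) => [kn|nk]; last by rewrite (leq_trans (card_le_ord _)).
  rewrite leqNgt; apply/negP => h.
  have : Ordinal kn \in unfinished c by rewrite mem_unfinished.
  rewrite inE ffunE /=; have := cj (Ordinal kn).
  have [inc _] := validP _ vc; have := inc k (Ordinal kn) (ltnSn k).
  by have := valid_le_final (Ordinal kn) vc; rewrite ffunE /=; lia.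
right; exists k => //.
have := cardsD1 k (unfinished c); rewrite -UE kU cU add1n => -[<-].
by split => //; lia.
Qed.

(** The two statistics are never below n together, although they vanish at opposite
    ends of time: this turns an upper tail of Z into a lower tail of Y. *)
Definition dual_stats (n : nat) (Y Z : config n -> nat) : Prop :=
  forall c, valid c -> (Y c < n)%N -> (n <= Z c)%N.

Lemma dual_last_unfinished (n : nat) (i : 'I_n) : i.+1 = n ->
  dual_stats (stat_last i) (@stat_unfinished n).
Proof.
move=> iE c vc; rewrite /stat_last /stat_unfinished => h.
suff : i \in unfinished c by rewrite mem_unfinished // iE.
by rewrite inE ffunE; lia.
Qed.

Lemma dual_unfinished_last (n : nat) (i : 'I_n) : i.+1 = n ->
  dual_stats (@stat_unfinished n) (stat_last i).
Proof.
move=> iE c vc; rewrite /stat_last /stat_unfinished => h.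
have : i \notin unfinished c by rewrite mem_unfinished // iE -ltnNge.
by rewrite inE ffunE negbK => /eqP; lia.
Qed.

Lemma dual_first_moved (n : nat) (i : 'I_n) : i = 0%N :> nat ->
  dual_stats (stat_first i) (@stat_moved n).
Proof.
move=> iE c vc; rewrite /stat_first /stat_moved => h.
have : i \notin unmoved c by rewrite inE ffunE iE; lia.
by rewrite mem_unmoved // iE; lia.
Qed.

Lemma dual_moved_first (n : nat) (i : 'I_n) : i = 0%N :> nat ->
  dual_stats (@stat_moved n) (stat_first i).
Proof.
move=> iE c vc; rewrite /stat_first /stat_moved => h.
have : i \in unmoved c by rewrite mem_unmoved // iE; lia.
by rewrite inE ffunE iE => /eqP; lia.
Qed.

Definition stat_start (n : nat) (up : bool) (Y : config n -> nat) : Prop :=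
  Y (if up then init_config n else final_config n) = 0%N.

Lemma start_last (n : nat) (i : 'I_n) : i.+1 = n -> stat_start true (stat_last i).
Proof. by move=> iE; rewrite /stat_start /stat_last ffunE iE subnn. Qed.

Lemma start_first (n : nat) (i : 'I_n) : i = 0%N :> nat -> stat_start false (stat_first i).
Proof. by move=> iE; rewrite /stat_start /stat_first ffunE iE; lia. Qed.

Lemma start_moved (n : nat) : stat_start true (@stat_moved n).
Proof.
rewrite /stat_start /stat_moved (_ : unmoved _ = [set: 'I_n]%SET) ?cardsT ?card_ord ?subnn //.
by apply/finset.setP => j; rewrite !inE eqxx.
Qed.

Lemma start_unfinished (n : nat) : stat_start false (@stat_unfinished n).
Proof.
rewrite /stat_start /stat_unfinished (_ : unfinished _ = finset.set0) ?cards0 //.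
by apply/finset.setP => j; rewrite !inE eqxx.
Qed.

(** * Tail bounds *)

Lemma mean_le (R : realType) (n : nat) (f g : instructions n -> R) :
  (forall s, s \in jump_sequences n -> f s <= g s) -> mean f <= mean g.
Proof. by move=> fg; rewrite ler_wpM2r ?invr_ge0 // ler_sum. Qed.

Lemma eq_mean (R : realType) (n : nat) (f g : instructions n -> R) :
  (forall s, s \in jump_sequences n -> f s = g s) -> mean f = mean g.
Proof. by move=> fg; rewrite /mean (eq_bigr _ fg). Qed.

Lemma mean_cst (R : realType) (n : nat) (a : R) :
  mean (fun _ : instructions n => a) = a.
Proof.
rewrite /mean sumr_const -[a *+ _]mulr_natr mulfK //.
by rewrite pnatr_eq0 -lt0n card_jump_sequences_gt0.
Qed.

Lemma meanD (R : realType) (n : nat) (f g : instructions n -> R) :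
  mean (fun s => f s + g s) = mean f + mean g.
Proof. by rewrite /mean big_split mulrDl. Qed.

Lemma meanZ (R : realType) (n : nat) (a : R) (f : instructions n -> R) :
  mean (fun s => a * f s) = a * mean f.
Proof. by rewrite /mean -mulr_sumr mulrA. Qed.

(** The time elapsed from the end at which the statistic vanishes. *)
Definition stat_time (n : nat) (up : bool) (m : nat) : nat :=
  if up then m else (n ^ 2 - m)%N.

Lemma stat_mean_gt0 (R : realType) (n : nat) (Y : config n -> nat) (w : nat -> R) (m : nat) :
  (forall j, 0 < w j) -> 0 < stat_mean Y w m.
Proof.
move=> w0; rewrite /stat_mean /mean divr_gt0 ?ltr0n ?card_jump_sequences_gt0 //.
have /card_gt0P[s0 s0O] := card_jump_sequences_gt0 n.
rewrite (bigD1 s0) //=; apply: ltr_pwDl => //.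
by apply: sumr_ge0 => s _; apply: ltW.
Qed.

(** Summing [mean_step] over the time steps: log E w(Y) is Lipschitz with constant K
    with respect to [time_angle]. Reversing time exchanges the factors m + 1 and
    n^2 - m, so that decreasing statistics are covered as well. *)
Lemma stat_mean_lipschitz (R : realType) (n : nat) (up right : bool)
    (Y : config n -> nat) (w : nat -> R) (K : R) (m m' : nat) :
  boundary_stat up right Y -> (forall j, 0 < w j) -> 0 <= K ->
  (forall j, (j < n)%N ->
     (w j.+1 - w j) ^+ 2 * (n%:R ^+ 2 - j%:R ^+ 2) <= K ^+ 2 * (w j * w j.+1)) ->
  (m <= m' <= n ^ 2)%N ->
  let f := expR (K * (time_angle R (n ^ 2) m' - time_angle R (n ^ 2) m)) in
  stat_mean Y w (stat_time n up m') <= stat_mean Y w (stat_time n up m) * f /\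
  stat_mean Y w (stat_time n up m) <= stat_mean Y w (stat_time n up m') * f.
Proof.
move=> hY w0 K0 hw /andP[]; elim: m' => [|m' IH] mm' mN /=.
  by move: mm'; rewrite leqn0 => /eqP ->; rewrite subrr mulr0 expR0 mulr1.
move: mm'; rewrite leq_eqVlt => /orP[/eqP ->|mm'].
  by rewrite subrr mulr0 expR0 mulr1.
have [IH1 IH2] := IH mm' (ltnW mN).
set a := stat_mean Y w (stat_time n up m') in IH1 IH2.
set b := stat_mean Y w (stat_time n up m'.+1).
have a0 : 0 < a by exact: stat_mean_gt0.
have b0 : 0 < b by exact: stat_mean_gt0.
pose ka := K / Num.sqrt (m'.+1%:R * (n ^ 2 - m')%:R).
have ka0 : 0 <= ka by rewrite divr_ge0 ?sqrtr_ge0.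
have st : `|b - a| <= ka * Num.sqrt (a * b).
  rewrite /ka /a /b /stat_time; case: up hY {IH IH1 IH2 a b a0 b0} => hY.
    exact: (mean_step hY).
  have -> : (n ^ 2 - m' = (n ^ 2 - m'.+1).+1)%N by lia.
  rewrite distrC [_ * stat_mean _ _ (_ - _)%N]mulrC [m'.+1%:R * _]mulrC.
  have := mean_step hY w0 K0 hw (m := (n ^ 2 - m'.+1)%N).
  have -> : (n ^ 2 - (n ^ 2 - m'.+1) = m'.+1)%N by lia.
  by apply; lia.
have kaG : ka <= K * (time_angle R (n ^ 2) m'.+1 - time_angle R (n ^ 2) m').
  by rewrite /ka -[_^-1]mul1r; apply: ler_wpM2l => //; apply: time_angle_step.
have eka : expR ka <= expR (K * (time_angle R (n ^ 2) m'.+1 - time_angle R (n ^ 2) m')).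
  by rewrite ler_expR.
have -> : K * (time_angle R (n ^ 2) m'.+1 - time_angle R (n ^ 2) m) =
  K * (time_angle R (n ^ 2) m' - time_angle R (n ^ 2) m) +
  K * (time_angle R (n ^ 2) m'.+1 - time_angle R (n ^ 2) m') by ring.
rewrite expRD; split.
  have h := ratio_le_expR a0 b0 ka0 st.
  apply: (le_trans h); rewrite mulrA.
  by rewrite ler_pM ?expR_ge0 ?(ltW a0).
rewrite distrC [a * b]mulrC in st.
have h := ratio_le_expR b0 a0 ka0 st.
apply: (le_trans IH2); rewrite mulrCA mulrC ler_wpM2l ?expR_ge0 //.
by apply: (le_trans h); rewrite ler_wpM2l // ltW.
Qed.

Lemma growth_weightS (R : realType) (n : nat) (s : R) (j : nat) : (j < n)%N ->
  let r := Num.sqrt (n%:R ^+ 2 - j%:R ^+ 2) in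
  [/\ 0 < r, r ^+ 2 = n%:R ^+ 2 - j%:R ^+ 2 &
    growth_weight n s j.+1 = growth_weight n s j * (1 + s / r)].
Proof.
move=> jn r; have d0 : 0 < n%:R ^+ 2 - j%:R ^+ 2 :> R.
  by rewrite subr_gt0 ltrXn2r ?nnegrE // ltr_nat.
by split; [rewrite sqrtr_gt0|rewrite sqr_sqrtr // ltW|rewrite /growth_weight big_ord_recr].
Qed.

Lemma growth_weight_gt0 (R : realType) (n : nat) (s : R) (j : nat) : 0 <= s ->
  0 < growth_weight n s j.
Proof. by move=> s0; apply: (lt_le_trans ltr01); apply: growth_weight_ge1. Qed.

Lemma growth_weight_step (R : realType) (n : nat) (s : R) (j : nat) : 0 <= s -> (j < n)%N ->
  (growth_weight n s j.+1 - growth_weight n s j) ^+ 2 * (n%:R ^+ 2 - j%:R ^+ 2) <=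
  s ^+ 2 * (growth_weight n s j * growth_weight n s j.+1).
Proof.
move=> s0 jn; have [r0 rE wS] := growth_weightS s jn.
have w0 := growth_weight_gt0 n j s0; rewrite -rE.
move: (Num.sqrt _) r0 {rE} wS => r r0 wS.
have le : growth_weight n s j <= growth_weight n s j.+1 by apply: growth_weight_homo.
have -> : (growth_weight n s j.+1 - growth_weight n s j) ^+ 2 * r ^+ 2 =
   s ^+ 2 * (growth_weight n s j * growth_weight n s j).
  by rewrite wS; field; rewrite lt0r_neq0.
by rewrite ler_wpM2l ?sqr_ge0 // ler_wpM2l // ltW.
Qed.

Lemma growth_weightV_step (R : realType) (n : nat) (s : R) (j : nat) : 0 <= s -> (j < n)%N ->
  ((growth_weight n s j.+1)^-1 - (growth_weight n s j)^-1) ^+ 2 * (n%:R ^+ 2 - j%:R ^+ 2) <=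
  s ^+ 2 * ((growth_weight n s j)^-1 * (growth_weight n s j.+1)^-1).
Proof.
move=> s0 jn; have := growth_weight_step s0 jn.
have w0 := growth_weight_gt0 n j s0; have w1 := growth_weight_gt0 n j.+1 s0.
move: (growth_weight n s j) (growth_weight n s j.+1) w0 w1 => a b a0 b0 h.
have ab : 0 < (a * b) ^- 2 by rewrite invr_gt0 exprn_gt0 // mulr_gt0.
have {h} := ler_wpM2r (ltW ab) h.
have -> : s ^+ 2 * (a * b) * (a * b) ^- 2 = s ^+ 2 * (a^-1 * b^-1).
  by field; rewrite !lt0r_neq0.
suff -> : (b - a) ^+ 2 * (n%:R ^+ 2 - j%:R ^+ 2) * (a * b) ^- 2 =
  (b^-1 - a^-1) ^+ 2 * (n%:R ^+ 2 - j%:R ^+ 2) by [].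
by field; rewrite !lt0r_neq0.
Qed.

Definition prob (R : realType) (n : nat) (E : pred (instructions n)) : R :=
  mean (fun s => (E s)%:R).

Lemma prob_le (R : realType) (n : nat) (E F : pred (instructions n)) :
  (forall s, s \in jump_sequences n -> E s -> F s) -> prob R E <= prob R F.
Proof.
move=> EF; apply: mean_le => s sO; rewrite ler_nat.
by case: (boolP (E s)) => // /(EF _ sO) ->.
Qed.

Lemma valid_config_at (n m : nat) (s : instructions n) :
  s \in jump_sequences n -> valid (config_at s m).
Proof.
rewrite inE jump_sequenceE => /andP[vs _]; apply: (valid_run (valid_init n)).
by move: vs; rewrite -{1}(cat_take_drop m s) valid_path_cat => /andP[].
Qed.

Lemma config_at_start (n : nat) (up : bool) (s : instructions n) :
  s \in jump_sequences n ->
  config_at s (stat_time n up 0) = if up then init_config n else final_config n.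
Proof.
rewrite inE => /andP[_ /eqP fin]; case: up; first by rewrite /config_at take0.
by rewrite /stat_time subn0.
Qed.

Lemma upper_tail_weight (R : realType) (n : nat) (up right : bool)
    (Y : config n -> nat) (s : R) (m y : nat) :
  boundary_stat up right Y -> stat_start up Y -> 0 <= s -> (m <= n ^ 2)%N ->
  prob R (fun t => y <= Y (config_at t (stat_time n up m)))%N <=
  expR (s * time_angle R (n ^ 2) m) / growth_weight n s y.
Proof.
move=> hY Y0 s0 mN; have w0 j := growth_weight_gt0 n j s0.
have [h _] := stat_mean_lipschitz hY w0 s0 (fun j jn => growth_weight_step s0 jn)
   (m := 0) (m' := m) mN.
rewrite time_angle0 subr0 in h.
have e0 : stat_mean Y (growth_weight n s) (stat_time n up 0) = 1.
  rewrite -[RHS](@mean_cst R n); apply: eq_mean => t tO.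
  by rewrite config_at_start // Y0 /growth_weight big_ord0.
rewrite e0 mul1r in h; rewrite ler_pdivlMr // mulrC -meanZ; apply: le_trans h.
apply: mean_le => t _; case: (leqP y) => [yY|_]; last by rewrite mulr0 ltW.
by rewrite mulr1 growth_weight_homo.
Qed.

Lemma pihalf_le2 (R : realType) : pi / 2 <= (2 : R).
Proof. by have /andP[_ /ltW] := pihalf_02 R. Qed.

Lemma slowdown_le (R : realType) (th u : R) : 0 <= th <= 2 -> 0 <= u ->
  th - 2 * u <= th / (1 + u).
Proof. by move=> /andP[t0 t2] u0; rewrite ler_pdivlMr; nra. Qed.

(** Markov's inequality from the time at which Y = 0, where the mean of the weight
    is 1. A difference of 2 e between cosines is a difference of at least 2 e
    between angles, and the error s^2 / sqrt n made in the weight costs at most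
    half of it. *)
Lemma upper_tail (R : realType) (n : nat) (up right : bool)
    (Y : config n -> nat) (s e : R) (m y : nat) :
  boundary_stat up right Y -> stat_start up Y -> 0 <= s -> (m <= n ^ 2)%N ->
  (y < n)%N -> 0 <= e -> 2 * (s / Num.sqrt n%:R) <= e ->
  cos (asin (y%:R / n%:R)) + 2 * e <= 1 - 2 * m%:R / (n ^ 2)%:R ->
  prob R (fun t => y < Y (config_at t (stat_time n up m)))%N <= expR (- (s * e)).
Proof.
move=> hY Y0 s0 mN yn e0 he hm.
apply: (le_trans (upper_tail_weight y.+1 hY Y0 s0 mN)).
have w0 := growth_weight_gt0 n y.+1 s0.
rewrite ler_pdivrMr //; apply: le_trans; last first.
  by apply: ler_wpM2l (growth_weight_ge s0 yn); apply: expR_ge0.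
rewrite -expRD ler_expR; have xi := space_angle_ge R yn.
have /andP[t0 tpi] := asin_ratio_itv R (ltnW yn); have pi2 := pihalf_le2 R.
have /andP[g0 gpi] := time_angle_itv R mN; have p0 := pi_ge0 R.
set th := asin _ in hm xi t0 tpi; set G := time_angle _ _ _ in g0 gpi *.
have cG : cos G = 1 - 2 * m%:R / (n ^ 2)%:R by rewrite cos_time_angle.
have Gth : G <= th by apply: cos_le_inv; rewrite ?g0 ?t0 //=; lra.
have := cos_sub_le g0 Gth; rewrite cG => /(_ ltac:(lra)) hG.
set u := s / Num.sqrt _ in he *; have u0 : 0 <= u by rewrite divr_ge0 ?sqrtr_ge0.
have := @slowdown_le R th u; rewrite t0 u0 => /(_ ltac:(lra) isT) sl.
have : s * (th / (1 + u)) <= s * space_angle R n y.+1 / (1 + u).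
  by rewrite -mulrA ler_wpM2l // ler_wpM2r // invr_ge0; lra.
have : s * G <= s * (th - 2 * e) by rewrite ler_wpM2l //; lra.
have : s * (th - e) <= s * (th / (1 + u)) by rewrite ler_wpM2l //; lra.
lra.
Qed.

(** If Y is below n, then the dual statistic is n. Counted from its own end of
    time this happens too early, and its upper tail excludes it. *)
Lemma lower_tail_far (R : realType) (n : nat) (up right : bool)
    (Y Z : config n -> nat) (s e : R) (m : nat) :
  boundary_stat (~~ up) right Z -> stat_start (~~ up) Z -> dual_stats Y Z ->
  (0 < n)%N -> 0 <= s -> 0 <= e -> 2 * (s / Num.sqrt n%:R) <= e / 2 ->
  pi / 2 - asin (n.-1%:R / n%:R) <= e -> (m <= n ^ 2)%N ->
  1 / 2 + e <= m%:R / (n ^ 2)%:R ->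
  prob R (fun t => Y (config_at t (stat_time n up m)) < n)%N <= expR (- (s * (e / 2))).
Proof.
move=> hZ Z0 YZ n0 s0 e0 he han mN hm.
have nn : (n.-1 < n)%N by rewrite ltn_predL.
have /andP[t0 tpi] := asin_ratio_itv R (ltnW nn).
have N0 : 0 < (n ^ 2)%:R :> R by rewrite ltr0n expn_gt0 n0.
apply: (@le_trans _ _ (prob R (fun t => n.-1 < Z (config_at t (stat_time n (~~ up) (n ^ 2 - m))))%N)).
  apply: prob_le => t tO /(YZ _ (valid_config_at _ tO)).
  rewrite prednK //; congr (_ <= Z (config_at t _))%N.
  by rewrite /stat_time; case: up {hZ Z0} => //=; rewrite subKn.
apply: (upper_tail hZ Z0) => //; first by rewrite leq_subr.
  by rewrite divr_ge0.
have := cos_sub_le t0 tpi; rewrite cos_pihalf subr0 => /(_ ltac:(have := pi_ge0 R; lra)) hc.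
rewrite natrB // mulrBr mulrBl mulfK ?lt0r_neq0 //.
rewrite -mulrA; lra.
Qed.

(** Markov's inequality for the inverse weight, carried backwards from a time
    slightly after the middle. At that time Y = n except on an event whose
    probability, by [lower_tail_far] with the larger parameter 6 s / d, is too
    small for the inverse weight to matter. The constant d is such that the chosen
    time has an angle of at most pi / 2 + e / 2. *)
Lemma lower_tail (R : realType) (n : nat) (up right right' : bool)
    (Y Z : config n -> nat) (s e d : R) (m y : nat) :
  boundary_stat up right Y ->
  boundary_stat (~~ up) right' Z -> stat_start (~~ up) Z -> dual_stats Y Z ->
  (0 < n)%N -> 0 <= s -> 0 < e < 1 -> d = sin (e / 2) / 4 ->
  2 * (6 / d * s / Num.sqrt n%:R) <= d / 2 -> 2 * (s / Num.sqrt n%:R) <= e / 4 ->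
  pi / 2 - asin (n.-1%:R / n%:R) <= d -> pi / 2 - asin (n.-1%:R / n%:R) <= e / 4 ->
  1 <= d * (n ^ 2)%:R ->
  (m <= n ^ 2)%N -> (y < n)%N ->
  1 - 2 * m%:R / (n ^ 2)%:R <= cos (asin (y%:R / n%:R)) - 2 * e ->
  prob R (fun t => Y (config_at t (stat_time n up m)) <= y)%N <= 2 * expR (- (s * e)).
Proof.
move=> hY hZ Z0 YZ n0 s0 /andP[e0 e1] dE hs2 hs1 hd he hN mN yn hm.
have pi2 := pihalf_le2 R; have pi1 := pihalf_ge1 R; have p0 := pi_ge0 R.
have N0 : 0 < (n ^ 2)%:R :> R by rewrite ltr0n expn_gt0 n0.
have d0 : 0 < d by rewrite dE divr_gt0 // sin_gt0_pihalf //; lra.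
have d14 : d <= 1 / 4 by rewrite dE; have := sin_le1 (e / 2); lra.
have s20 : 0 <= 6 / d * s by rewrite mulr_ge0 // divr_ge0 // ltW.
have far m1 : (m1 <= n ^ 2)%N -> 1 / 2 + d <= m1%:R / (n ^ 2)%:R ->
    prob R (fun t => Y (config_at t (stat_time n up m1)) < n)%N <= expR (- (3 * s)).
  move=> m1N hm1; apply: (le_trans (lower_tail_far hZ Z0 YZ n0 s20 (ltW d0) hs2 hd m1N hm1)).
  by rewrite ler_expR; have -> : 6 / d * s * (d / 2) = 3 * s by field; rewrite lt0r_neq0.
case: (lerP (1 / 2 + d) (m%:R / (n ^ 2)%:R)) => [hm1|hm1].
  apply: (@le_trans _ _ (prob R (fun t => Y (config_at t (stat_time n up m)) < n)%N)).
    by apply: prob_le => t _ h; apply: (leq_ltn_trans h).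
  apply: (le_trans (far _ mN hm1)).
  have : expR (- (3 * s)) <= expR (- (s * e)) by rewrite ler_expR; nra.
  by have := expR_gt0 (- (s * e)); lra.
(* A time slightly after the middle, at which Y is n with high probability. *)
pose x := (1 / 2 + d) * (n ^ 2)%:R.
have x0 : 0 <= x by rewrite mulr_ge0 ?(ltW N0) //; lra.
pose m' := (Num.truncn x).+1.
have /andP[tr1 tr2] := truncn_itv x0.
have m'x : m'%:R <= (1 / 2 + 2 * d) * (n ^ 2)%:R 
  by rewrite /m' -natr1 (_ : _ * _ = x + d * (n ^ 2)%:R); [lra|rewrite /x; ring].
have m'N : (m' <= n ^ 2)%N by rewrite -(ler_nat R); nra.
have mm' : (m <= m')%N.
  by rewrite ltnW // -(ltr_nat R); apply: lt_trans tr2; rewrite -ltr_pdivrMr.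
have hm' : 1 / 2 + d <= m'%:R / (n ^ 2)%:R by rewrite ler_pdivlMr // ltW.
have /andP[g0 gpi] := time_angle_itv R mN.
have /andP[g0' gpi'] := time_angle_itv R m'N.
have /andP[t0 tpi] := asin_ratio_itv R (ltnW yn).
have nn : (n.-1 < n)%N by rewrite ltn_predL.
have /andP[a0 api] := asin_ratio_itv R (ltnW nn).
have G'le : time_angle R (n ^ 2) m' <= e / 2 + pi / 2.
  apply: cos_le_inv; [by rewrite g0'|lra|].
  rewrite cosDpihalf cos_time_angle //.
  have : m'%:R / (n ^ 2)%:R <= 1 / 2 + 2 * d by rewrite ler_pdivrMr.
  by rewrite -mulrA; have : sin (e / 2) = 4 * d; [rewrite dE; field|lra].
have Gge : asin (y%:R / n%:R) + 2 * e <= time_angle R (n ^ 2) m.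
  have cG := cos_time_angle R mN.
  have le : asin (y%:R / n%:R) <= time_angle R (n ^ 2) m.
    by apply: cos_le_inv; rewrite ?g0 ?t0 //=; lra.
  by have := cos_sub_le t0 le gpi; lra.
have w0 j := growth_weight_gt0 n j s0.
have wV0 j : 0 < (growth_weight n s j)^-1 by rewrite invr_gt0.
have mm'N : (m <= m' <= n ^ 2)%N by rewrite mm'.
have [_ h] := stat_mean_lipschitz hY wV0 s0 (fun j jn => growth_weightV_step s0 jn) mm'N.
have full : stat_mean Y (fun j => (growth_weight n s j)^-1) (stat_time n up m') <=
    (growth_weight n s n)^-1 + expR (- (3 * s)).
  apply: (@le_trans _ _ ((growth_weight n s n)^-1 +
     prob R (fun t => Y (config_at t (stat_time n up m')) < n)%N)); last first.
    by rewrite lerD2l; apply: far.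
  rewrite -[X in X + _](@mean_cst R n) -meanD; apply: mean_le => t _.
  case: (ltnP _ n) => Yn; last by rewrite addr0 lef_pV2 ?posrE // growth_weight_homo.
  apply: ler_wpDl; first exact: ltW.
  by rewrite invf_le1 // growth_weight_ge1.
have markov : prob R (fun t => Y (config_at t (stat_time n up m)) <= y)%N <=
    growth_weight n s y * stat_mean Y (fun j => (growth_weight n s j)^-1) (stat_time n up m).
  rewrite -meanZ; apply: mean_le => t _.
  case: (leqP _ y) => Yy; last by rewrite mulr_ge0 // ltW.
  by rewrite ler_pdivlMr // mul1r growth_weight_homo.
have wy : growth_weight n s y <= expR (s * asin (y%:R / n%:R)).
  apply: (le_trans (growth_weight_le n y s0)); rewrite ler_expR ler_wpM2l //.
  exact/space_angle_le/ltnW.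
set u := s / Num.sqrt n%:R in hs1; have u0 : 0 <= u by rewrite divr_ge0 ?sqrtr_ge0.
have wn : (growth_weight n s n)^-1 <= expR (- (s * (pi / 2 - e / 2))).
  rewrite expRN lef_pV2 ?posrE ?expR_gt0 //.
  apply: le_trans (growth_weight_ge s0 (leqnn n)); rewrite ler_expR -/u -mulrA ler_wpM2l //.
  have := space_angle_ge R nn; rewrite prednK // => xi.
  apply: (@le_trans _ _ (asin (n.-1%:R / n%:R) / (1 + u))).
    have := @slowdown_le R (asin (n.-1%:R / n%:R)) u.
    by rewrite a0 u0 => /(_ ltac:(lra) isT); lra.
  by rewrite ler_wpM2r // invr_ge0; lra.
apply: (le_trans markov); apply: (le_trans (ler_wpM2l (ltW (w0 y)) h)).
set f := expR (s * (_ - _)).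
have fle : f <= expR (s * (e / 2 + pi / 2 - (asin (y%:R / n%:R) + 2 * e))).
  by rewrite ler_expR ler_wpM2l //; lra.
apply: (@le_trans _ _ (expR (s * asin (y%:R / n%:R)) *
   ((expR (- (s * (pi / 2 - e / 2))) + expR (- (3 * s))) *
    expR (s * (e / 2 + pi / 2 - (asin (y%:R / n%:R) + 2 * e)))))).
  apply: ler_pM => //; first exact: ltW.
    by rewrite mulr_ge0 ?expR_ge0 // ltW // stat_mean_gt0.
  apply: ler_pM => //; [by rewrite ltW // stat_mean_gt0|exact: expR_ge0|].
  by apply: (le_trans full); rewrite lerD2r.
rewrite mulrDl mulrDr -!expRD [leRHS]mulr_natl [leRHS]mulr2n.
by apply: lerD; rewrite ler_expR; nra.
Qed.

(** * First and last touches as level crossings *)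

Lemma step_at (n : nat) (s : instructions n) (i : 'I_(n ^ 2)) :
  s \in jump_sequences n ->
  let c := config_at s i in
  [/\ valid c, may_jump c (tnth s i) & config_at s i.+1 = jump c (tnth s i)].
Proof.
move=> sO /=; have vc := valid_config_at i sO.
split=> //; first by move: sO; rewrite inE => /andP[/forallP].
rewrite /config_at (take_nth (tnth s i)) ?size_tuple // -cats1 foldl_cat /=.
by rewrite -tnth_nth.
Qed.

(** A discrete intermediate value theorem: positions grow by unit steps. *)
Lemma jump_from (n : nat) (s : instructions n) (j : 'I_n) (p m m' : nat) :
  (m' <= n ^ 2)%N -> (m <= m')%N ->
  (config_at s m j <= p)%N -> (p < config_at s m' j)%N ->
  exists i : 'I_(n ^ 2), [/\ (m <= i < m')%N, tnth s i = j & config_at s i j = p].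
Proof.
elim: m' => [|m' IH] mN.
  by rewrite leqn0 => /eqP -> h1 h2; lia.
rewrite leq_eqVlt => /orP[/eqP -> h1 h2|mm' h1 h2]; first by lia.
case: (ltnP p (config_at s m' j)) => [h3|h3].
  by have [i [/andP[i1 i2] i3 i4]] := IH (ltnW mN) mm' h1 h3; exists i; split; rewrite ?i1 // ltnW.
exists (Ordinal mN); move: h2.
rewrite {1}/config_at (take_nth j) ?size_tuple // -cats1 foldl_cat /= ffunE.
rewrite -/(config_at s m') -(tnth_nth j s (Ordinal mN)).
by case: eqP => [<- h2|_ h2]; [split => //=; lia|lia].
Qed.

Lemma config_at_end (n : nat) (s : instructions n) :
  s \in jump_sequences n -> config_at s (n ^ 2) = final_config n.
Proof. by rewrite inE => /andP[_ /eqP]. Qed.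

Lemma config_at_0 (n : nat) (s : instructions n) : config_at s 0 = init_config n.
Proof. by rewrite /config_at take0. Qed.

(** The first touch of k is the step at which Y first exceeds y. *)
Definition first_touch_stat (n : nat) (Y : config n -> nat) (s : instructions n)
    (y k : nat) : Prop :=
  [/\ forall i, touches s k i -> (y < Y (config_at s i.+1))%N,
      forall m, (m <= n ^ 2)%N -> (y < Y (config_at s m))%N ->
        exists2 i : 'I_(n ^ 2), (i < m)%N & touches s k i
    & (y < Y (final_config n))%N].

(** The last touch of k is the last step at whose start Y exceeds y. *)
Definition last_touch_stat (n : nat) (Y : config n -> nat) (s : instructions n)
    (y k : nat) : Prop :=
  [/\ forall i, touches s k i -> (y < Y (config_at s i))%N,
      forall m, (m <= n ^ 2)%N -> (y < Y (config_at s m))%N ->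
        exists2 i : 'I_(n ^ 2), (m <= i)%N & touches s k i
    & (y < Y (init_config n))%N].

(** Position k above n is first touched when the last particle arrives there. *)
Lemma first_touch_last (n : nat) (l : 'I_n) (s : instructions n) (y : nat) :
  l.+1 = n -> (y < n)%N -> s \in jump_sequences n ->
  first_touch_stat (stat_last l) s y (n + y.+1).
Proof.
move=> lE yn sO; split=> [i|m mN|]; rewrite /stat_last.
- have [vc mj e] := step_at i sO; have := valid_config_at i.+1 sO.
  rewrite /touches; set k := tnth s i in mj e * => v1 h.
  have kl : (k <= l)%N by have := ltn_ord k; lia.
  by have := valid_gap v1 kl; rewrite e jumpE eqxx; lia.
- move=> h; have := @jump_from n s l (n + y) 0 m mN (leq0n m).
  rewrite config_at_0 ffunE => /(_ ltac:(lia) ltac:(lia)) [i [/andP[_ im] ti ci]].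
  by exists i => //; rewrite /touches ti ci addnS eqxx orbT.
- by rewrite ffunE; lia.
Qed.

(** Position k up to n is first touched when its initial occupant leaves it. *)
Lemma first_touch_moved (n : nat) (s : instructions n) (y : nat) :
  (y < n)%N -> s \in jump_sequences n ->
  first_touch_stat (@stat_moved n) s y (n - y).
Proof.
move=> yn sO; have kn : (n - y.+1 < n)%N by lia.
pose k0 := Ordinal kn.
have statE c : valid c -> (y < stat_moved c)%N = (c k0 != n - y)%N.
  move=> vc; have := mem_unmoved k0 vc; rewrite inE ffunE /= /stat_moved.
  rewrite (_ : (n - y.+1).+1 = n - y)%N; last lia.
  by move=> ->; rewrite -ltnNge; apply/idP/idP; move: #|unmoved c| => u; lia.
split=> [i|m mN|].
- have [vc mj e] := step_at i sO; rewrite statE ?valid_config_at // e jumpE.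
  have [_ free] := may_jumpP _ _ mj; have := valid_ge_init k0 vc; rewrite ffunE /=.
  rewrite /touches; case: (k0 =P _) => [_|ne] ge; first by move=> _; lia.
  case/orP => /eqP h; last by rewrite -h; apply: free.
  by apply/eqP => h'; apply: ne; apply: (valid_inj vc); rewrite h h'.
- rewrite statE ?valid_config_at // => h.
  have := @jump_from n s k0 (n - y) 0 m mN (leq0n m).
  have := valid_ge_init k0 (valid_config_at m sO).
  rewrite config_at_0 ffunE /= => ge /(_ ltac:(lia) ltac:(lia)) [i [im ti ci]].
  by exists i => //; rewrite /touches ti ci eqxx.
- by rewrite -(config_at_end sO) statE ?valid_config_at // config_at_end // ffunE /=; lia.
Qed.

(** Position k up to n is last touched when the first particle leaves it. *)
Lemma last_touch_first (n : nat) (l : 'I_n) (s : instructions n) (y : nat) :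
  l = 0%N :> nat -> (y < n)%N -> s \in jump_sequences n ->
  last_touch_stat (stat_first l) s y (n - y).
Proof.
move=> lE yn sO; split=> [i|m mN|]; rewrite /stat_first.
- have [vc mj e] := step_at i sO; rewrite /touches; set k := tnth s i => h.
  have lk : (l <= k)%N by lia.
  by have := valid_gap vc lk; lia.
- move=> h; have := @jump_from n s l (n - y) m (n ^ 2) (leqnn _) mN.
  rewrite config_at_end // ffunE => /(_ ltac:(lia) ltac:(lia)) [i [/andP[im _] ti ci]].
  by exists i => //; rewrite /touches ti ci eqxx.
- by rewrite ffunE; lia.
Qed.

(** Position k above n is last touched when its final occupant arrives there. *)
Lemma last_touch_unfinished (n : nat) (s : instructions n) (y : nat) :
  (y < n)%N -> s \in jump_sequences n ->
  last_touch_stat (@stat_unfinished n) s y (n + y.+1).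
Proof.
move=> yn sO; pose k0 := Ordinal yn.
have statE c : valid c -> (y < stat_unfinished c)%N = (c k0 != n + y.+1)%N.
  by move=> vc; have := mem_unfinished k0 vc; rewrite inE ffunE /= /stat_unfinished => ->.
split=> [i|m mN|].
- have [vc mj e] := step_at i sO; rewrite statE //.
  have := valid_le_final k0 (valid_config_at i.+1 sO); rewrite e jumpE ffunE /=.
  have [_ free] := may_jumpP _ _ mj; rewrite /touches.
  case: (k0 =P _) => [_|ne] le; first by move=> _; lia.
  case/orP => /eqP h; last by rewrite -h; apply: free.
  by apply/eqP => h'; apply: ne; apply: (valid_inj vc); rewrite h h'.
- rewrite statE ?valid_config_at // => h.
  have := @jump_from n s k0 (n + y) m (n ^ 2) (leqnn _) mN.
  have := valid_le_final k0 (valid_config_at m sO).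
  rewrite config_at_end // ffunE /= => ge /(_ ltac:(lia) ltac:(lia)) [i [/andP[im _] ti ci]].
  by exists i => //; rewrite /touches ti ci addnS eqxx orbT.
- by rewrite -(config_at_0 s) statE ?valid_config_at // config_at_0 ffunE /=; lia.
Qed.

Lemma tau_minus_le (n k : nat) (s : instructions n) (i : 'I_(n ^ 2)) :
  touches s k i -> (tau_minus s k <= i.+1)%N.
Proof.
move=> ti; rewrite /tau_minus; elim: (index_enum _) (mem_index_enum i) => // j r IH.
rewrite inE big_cons => /orP[/eqP <-|/IH h]; first by rewrite ti geq_minl.
by case: ifP => // _; rewrite geq_min h orbT.
Qed.

Lemma tau_minus_bracket (n : nat) (Y : config n -> nat) (s : instructions n) (y k : nat) :
  s \in jump_sequences n -> first_touch_stat Y s y k ->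
  let t := tau_minus s k in
  [/\ (0 < t <= n ^ 2)%N, (y < Y (config_at s t))%N & (Y (config_at s t.-1) <= y)%N].
Proof.
move=> sO [h1 h2 h3] t.
have [i0 _ ti0] : exists2 i : 'I_(n ^ 2), (i < n ^ 2)%N & touches s k i.
  by apply: h2; rewrite // config_at_end.
have [i ti tE] : exists2 i, touches s k i & t = i.+1.
  have tle := tau_minus_le ti0.
  have : t = (n ^ 2)%N \/ exists2 i, touches s k i & t = i.+1.
    rewrite /t /tau_minus; apply: (big_ind (fun v => v = (n ^ 2)%N \/
       exists2 i, touches s k i & v = i.+1)); [by left| |by move=> i ti; right; exists i].
    by move=> a b ha hb; rewrite /minn; case: ifP.
  case=> // e; exists i0 => //; apply/eqP; rewrite eqn_leq tle e; exact: ltn_ord.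
split; first by rewrite tE; exact: ltn_ord.
  by rewrite tE; apply: h1.
rewrite leqNgt; apply/negP => /h2 [|j jt /tau_minus_le].
  by rewrite tE /= ltnW // ltn_ord.
by rewrite -/t tE in jt *; lia.
Qed.

Lemma tau_plus_bracket (n : nat) (Y : config n -> nat) (s : instructions n) (y k : nat) :
  s \in jump_sequences n -> last_touch_stat Y s y k ->
  let t := tau_plus s k in
  [/\ (0 < t <= n ^ 2)%N, (y < Y (config_at s t.-1))%N & (Y (config_at s t) <= y)%N].
Proof.
move=> sO [h1 h2 h3] t.
have tge i : touches s k i -> (i < t)%N.
  by move=> ti; exact: (bigop.leq_bigmax_cond (F := fun j : 'I_(n ^ 2) => j.+1)).
have [i0 _ ti0] : exists2 i : 'I_(n ^ 2), (0 <= i)%N & touches s k i.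
  by apply: h2; rewrite // config_at_0.
have [i ti tE] : exists2 i, touches s k i & t = i.+1.
  have := tge _ ti0.
  have : t = 0%N \/ exists2 i, touches s k i & t = i.+1.
    rewrite /t /tau_plus; apply: (big_ind (fun v => v = 0%N \/
       exists2 i, touches s k i & v = i.+1)); [by left| |by move=> i ti; right; exists i].
    by move=> a b ha hb; rewrite /maxn; case: ifP.
  by case=> // ->.
have tN : (t <= n ^ 2)%N by rewrite tE; exact: ltn_ord.
split; first by rewrite tE; exact: ltn_ord.
  by rewrite tE; apply: h1.
rewrite leqNgt; apply/negP => /(h2 _ tN) [j jt /tge].
by rewrite ltnNge jt.
Qed.

(** * Uniform tail bounds and the arctic curve *)

Definition fourth_root (R : realType) (n : nat) : R := Num.sqrt (Num.sqrt n%:R).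

Lemma fourth_rootE (R : realType) (n : nat) : fourth_root R n ^+ 4 = n%:R.
Proof. by rewrite (exprM _ 2 2) !sqr_sqrtr ?sqrtr_ge0. Qed.

Lemma sqr_fourth_root (R : realType) (n : nat) : fourth_root R n ^+ 2 = Num.sqrt n%:R.
Proof. by rewrite sqr_sqrtr ?sqrtr_ge0. Qed.

Lemma near_fourth_root (R : realType) (C : R) :
  \forall n \near \oo, C <= fourth_root R n.
Proof.
near=> n; have h : (Num.max 0 C) ^+ 4 <= n%:R by near: n; apply: nbhs_infty_ger.
apply: (@le_trans _ _ (Num.max 0 C)); first by rewrite le_max lexx orbT.
by rewrite -(@ler_pXn2r _ 4) ?nnegrE ?sqrtr_ge0 ?le_max ?lexx // fourth_rootE.
Unshelve. all: by end_near. Qed.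

Lemma asin_near_pihalf (R : realType) (d : R) : 0 < d -> exists C : R, forall n : nat,
  (0 < n)%N -> C <= n%:R -> pi / 2 - asin (n.-1%:R / n%:R) <= d.
Proof.
move=> d0; have pi1 := pihalf_ge1 R; pose b := Num.min d 1.
have b0 : 0 < b by rewrite lt_min d0 ltr01.
have b1 : b <= 1 by rewrite ge_min lexx orbT.
have bd : b <= d by rewrite ge_min lexx.
have cb : cos b < 1 by rewrite -cos0 ltr_cos ?in_itv //=; lra.
exists (1 - cos b)^-1 => n n0 hn; apply: le_trans bd.
have nn : (n.-1 <= n)%N by lia.
have /andP[a0 api] := asin_ratio_itv R nn.
have p0 : 0 < pi :> R := pi_gt0 R.
apply: cos_le_inv; [lra|lra|].
rewrite -[leRHS]cosN opprB cosBpihalf sin_asin_ratio //.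
have n0' : 0 < n%:R :> R by rewrite ltr0n.
rewrite -subn1 natrB // mulrBl divff ?lt0r_neq0 // mul1r.
have : n%:R^-1 <= 1 - cos b by rewrite -[leRHS]invrK lef_pV2 ?posrE ?invr_gt0 //; lra.
lra.
Qed.

(** The parameter s = n^(1/4) tends to infinity, while s / sqrt n tends to 0. *)
Lemma tails (R : realType) (e : R) : 0 < e < 1 -> exists C : R, forall n : nat,
  (0 < n)%N -> C <= fourth_root R n ->
  forall (up right right' : bool) (Y Z : config n -> nat),
  boundary_stat up right Y -> stat_start up Y ->
  boundary_stat (~~ up) right' Z -> stat_start (~~ up) Z -> dual_stats Y Z ->
  forall m y, (m <= n ^ 2)%N -> (y < n)%N ->
  (cos (asin (y%:R / n%:R)) + 2 * e <= 1 - 2 * m%:R / (n ^ 2)%:R ->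
   prob R (fun t => y < Y (config_at t (stat_time n up m)))%N <=
     2 * expR (- (fourth_root R n * e))) /\
  (1 - 2 * m%:R / (n ^ 2)%:R <= cos (asin (y%:R / n%:R)) - 2 * e ->
   prob R (fun t => Y (config_at t (stat_time n up m)) <= y)%N <=
     2 * expR (- (fourth_root R n * e))).
Proof.
move=> /andP[e0 e1]; pose d := sin (e / 2) / 4; have pi1 := pihalf_ge1 R.
have d0 : 0 < d by rewrite divr_gt0 // sin_gt0_pihalf //; lra.
have e40 : 0 < e / 4 by rewrite divr_gt0.
have [C1 hC1] := asin_near_pihalf d0; have [C2 hC2] := asin_near_pihalf e40.
pose C := 1 + `|C1| + `|C2| + 8 / e + 24 / d ^+ 2 + 1 / d.
have [p1 p2] : 0 <= `|C1| /\ 0 <= `|C2| by split.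
have p3 : 0 < 8 / e by rewrite divr_gt0.
have p4 : 0 < 24 / d ^+ 2 by rewrite divr_gt0 // exprn_gt0.
have p5 : 0 < 1 / d by rewrite divr_gt0.
exists C => n n0; set q := fourth_root R n => hq.
have q1 : 1 <= q by rewrite /C in hq; lra.
have q0 : 0 < q by lra.
have q2 : q <= q ^+ 2 by rewrite expr2 ler_peMr // ltW.
have qn : q ^+ 2 <= n%:R.
  by rewrite -fourth_rootE -/q (exprM _ 2 2) [leRHS]expr2 ler_peMr ?sqr_ge0 //; lra.
have n1 : 1 <= n%:R :> R by rewrite ler1n.
have nN : n%:R <= (n ^ 2)%:R :> R by rewrite natrX expr2 ler_peMr.
have sq : q / Num.sqrt n%:R = q^-1.
  by rewrite -sqr_fourth_root -/q; field; rewrite lt0r_neq0.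
have h1 : 2 * (q / Num.sqrt n%:R) <= e / 4.
  rewrite sq -[q^-1]div1r mulrA ler_pdivrMr // mulr1.
  have : e / 4 * (8 / e) <= e / 4 * q by rewrite ler_wpM2l ?(ltW e40) //; rewrite /C in hq; lra.
  by have -> : e / 4 * (8 / e) = 2 by field; rewrite lt0r_neq0.
have h2 : 2 * (6 / d * q / Num.sqrt n%:R) <= d / 2.
  rewrite -mulrA sq.
  have : q^-1 <= d ^+ 2 / 24.
    by rewrite -(invf_div 24) lef_pV2 ?posrE //; rewrite /C in hq; lra.
  have dd : 0 <= 12 / d by rewrite divr_ge0 // ltW.
  move=> /(ler_wpM2l dd).
  have -> : 12 / d * (d ^+ 2 / 24) = d / 2 by field; rewrite lt0r_neq0.
  by have -> : 12 / d / q = 2 * (6 / d / q) by ring.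
have h3 : pi / 2 - asin (n.-1%:R / n%:R) <= d.
  by apply: hC1 => //; have := ler_norm C1; rewrite /C in hq; lra.
have h4 : pi / 2 - asin (n.-1%:R / n%:R) <= e / 4.
  by apply: hC2 => //; have := ler_norm C2; rewrite /C in hq; lra.
have h5 : 1 <= d * (n ^ 2)%:R.
  have : d * (1 / d) <= d * (n ^ 2)%:R by rewrite ler_wpM2l ?(ltW d0) //; rewrite /C in hq; lra.
  by have -> : d * (1 / d) = 1 by field; rewrite lt0r_neq0.
move=> up right right' Y Z hY Y0 hZ Z0 YZ m y mN yn; split => hm; last first.
  by apply: (lower_tail hY hZ Z0 YZ n0 (ltW q0) _ (erefl d)) => //; rewrite e0.
have := upper_tail hY Y0 (ltW q0) mN yn (ltW e0) _ hm.
by move=> /(_ ltac:(lra)); have := expR_gt0 (- (q * e)); lra.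
Qed.

(** At some time and level the statistic violates the law that Y / n is close to
    sin th when the elapsed time is (1 - cos th) / 2, with tolerance e in
    elapsed time. *)
Definition strays (R : realType) (n : nat) (e : R) (up : bool) (Y : config n -> nat)
    (t : instructions n) : bool :=
  [exists i : 'I_(n ^ 2).+1 * 'I_n,
    let c := cos (asin (i.2%:R / n%:R)) in
    let x := 1 - 2 * i.1%:R / (n ^ 2)%:R in
    let v := Y (config_at t (stat_time n up i.1)) in
    ((c + 2 * e <= x) && (i.2 < v)%N) || ((x <= c - 2 * e) && (v <= i.2)%N)].

Lemma prob_exists_le (R : realType) (n : nat) (I : finType)
    (E : I -> pred (instructions n)) (b : R) :
  (forall i, prob R (E i) <= b) ->
  prob R (fun t => [exists i, E i t]) <= #|I|%:R * b.
Proof.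
move=> h; apply: (@le_trans _ _ (\sum_i prob R (E i))).
  rewrite /prob /mean -mulr_suml ler_wpM2r ?invr_ge0 // exchange_big /=.
  apply: ler_sum => t _; case: existsP => [[i Ei]|_]; last exact: sumr_ge0.
  by rewrite (bigD1 i) //= Ei lerDl sumr_ge0.
by rewrite mulr_natl -sumr_const ler_sum.
Qed.

Lemma prob_strays (R : realType) (e b : R) (n : nat) (up : bool) (Y : config n -> nat) :
  0 < e -> 0 <= b ->
  (forall m y, (m <= n ^ 2)%N -> (y < n)%N ->
  (cos (asin (y%:R / n%:R)) + 2 * e <= 1 - 2 * m%:R / (n ^ 2)%:R ->
   prob R (fun t => y < Y (config_at t (stat_time n up m)))%N <= b) /\
  (1 - 2 * m%:R / (n ^ 2)%:R <= cos (asin (y%:R / n%:R)) - 2 * e ->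
   prob R (fun t => Y (config_at t (stat_time n up m)) <= y)%N <= b)) ->
  prob R (strays e up Y) <= ((n ^ 2).+1 * n)%:R * b.
Proof.
move=> e0 b0 h; have -> : ((n ^ 2).+1 * n = #|{: 'I_(n ^ 2).+1 * 'I_n}|)%N.
  by rewrite card_prod !card_ord.
apply: prob_exists_le => -[m y] /=.
have [hu hl] := h m y (ltn_ord m) (ltn_ord y).
case: (lerP (cos (asin (y%:R / n%:R)) + 2 * e) (1 - 2 * m%:R / (n ^ 2)%:R)) => [h1|h1].
  apply: le_trans (hu h1); apply: prob_le => t _ /orP[//|/andP[h2 _]]; lra.
case: (lerP (1 - 2 * m%:R / (n ^ 2)%:R) (cos (asin (y%:R / n%:R)) - 2 * e)) => [h2|h2].
  by apply: le_trans (hl h2); apply: prob_le.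
rewrite (_ : prob _ _ = 0) // /prob -[RHS](@mean_cst R n); exact: eq_mean.
Qed.

(** With k = n + z or k = n - z, the square root in the arctic curve is
    sqrt (n^2 - z^2) / (2 n). Replacing z by y <= z <= y + 1 changes
    sqrt (n^2 - z^2) by at most sqrt (2 n). *)
Lemma phi_arg_close (R : realType) (n y z k : nat) (c := cos (asin (y%:R / n%:R)) : R) :
  (y < n)%N -> (y <= z <= y.+1)%N -> (k * (2 * n - k) = n ^ 2 - z ^ 2)%N ->
  (k <= 2 * n)%N ->
  `|Num.sqrt (k%:R / (2 * n%:R) * (1 - k%:R / (2 * n%:R))) - c / 2| <=
     (fourth_root R n)^-1 ^+ 2.
Proof.
move=> yn /andP[yz zy] kE k2; have n0 : (0 < n)%N by lia.
have n0' : 0 < n%:R :> R by rewrite ltr0n.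
have zn : (z <= n)%N by lia.
have dz : 0 <= n%:R ^+ 2 - z%:R ^+ 2 :> R.
  by rewrite subr_ge0 lerXn2r ?nnegrE // ler_nat.
have -> : k%:R / (2 * n%:R) * (1 - k%:R / (2 * n%:R)) =
    (n%:R ^+ 2 - z%:R ^+ 2) / (2 * n%:R) ^+ 2 :> R.
  have : (k * (2 * n - k))%:R = (n ^ 2 - z ^ 2)%:R :> R by rewrite kE.
  rewrite natrM !natrB ?leq_sqr // natrM !natrX => <-.
  by field; rewrite lt0r_neq0.
rewrite sqrtrM // sqrtrV ?sqr_ge0 // sqrtr_sqr (ger0_norm (x := 2 * n%:R)); last by rewrite mulr_ge0 // ltW.
rewrite /c cos_asin_ratio // 1?ltnW //.
set a := Num.sqrt _; set b := Num.sqrt _.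
have ab : a <= b.
  by rewrite ler_wsqrtr // lerB // lerXn2r ?nnegrE // ler_nat.
have a0 : 0 <= a by exact: sqrtr_ge0.
have b2 : b ^+ 2 = n%:R ^+ 2 - y%:R ^+ 2.
  by rewrite sqr_sqrtr // subr_ge0 lerXn2r ?nnegrE // ler_nat ltnW.
have a2 : a ^+ 2 = n%:R ^+ 2 - z%:R ^+ 2 by rewrite sqr_sqrtr.
have -> : a / (2 * n%:R) - b / n%:R / 2 = - ((b - a) / (2 * n%:R)).
  by field; rewrite lt0r_neq0.
have ba : 0 <= b - a by lra.
rewrite normrN ger0_norm ?divr_ge0 ?mulr_ge0 ?(ltW n0') //.
pose r : R := Num.sqrt n%:R; have r0 : 0 < r by rewrite sqrtr_gt0.
have r2 : r ^+ 2 = n%:R by rewrite sqr_sqrtr // ltW.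
rewrite exprVn sqr_fourth_root -/r -r2 ler_pdivrMr ?mulr_gt0 ?exprn_gt0 //.
have -> : r^-1 * (2 * r ^+ 2) = 2 * r by field; rewrite lt0r_neq0.
rewrite -(@ler_pXn2r _ 2) ?nnegrE //; last by rewrite mulr_ge0 // ltW.
have zy' : z%:R <= y%:R + 1 :> R by rewrite natr1 ler_nat.
have yn' : y%:R + 1 <= n%:R :> R by rewrite natr1 ler_nat.
have y0 : 0 <= y%:R :> R by [].
have z0 : 0 <= z%:R :> R by [].
have : (b - a) ^+ 2 <= b ^+ 2 - a ^+ 2 by nra.
rewrite exprMn r2 b2 a2; nra.
Qed.

Lemma strays_bracket (R : realType) (e : R) (n : nat) (up : bool) (Y : config n -> nat)
   (t : instructions n) (y m : nat) :
  ~~ strays e up Y t -> (y < n)%N -> (0 < m <= n ^ 2)%N ->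
  (y < Y (config_at t (stat_time n up m)))%N ->
  (Y (config_at t (stat_time n up m.-1)) <= y)%N ->
  let c := cos (asin (y%:R / n%:R)) in
  c - 2 * e < 1 - 2 * m.-1%:R / (n ^ 2)%:R /\ 1 - 2 * m%:R / (n ^ 2)%:R < c + 2 * e.
Proof.
move=> /existsPn ns yn /andP[m0 mN] h1 h2 c.
have mN' : (m < (n ^ 2).+1)%N by [].
have mN'' : (m.-1 < (n ^ 2).+1)%N by lia.
split.
  have := ns (Ordinal mN'', Ordinal yn) => /=.
  by rewrite h2 negb_or andbT -ltNge => /andP[_].
have := ns (Ordinal mN', Ordinal yn) => /=.
by rewrite h1 negb_or andbT -ltNge => /andP[].
Qed.

(** * Deviations of the touching times *)

Lemma bigmax_lt (R : realDomainType) (r : R) (a b : nat) (F : nat -> R) : 0 < r ->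
  (forall k, (a <= k < b)%N -> F k < r) -> \big[Num.max/0]_(a <= k < b) F k < r.
Proof.
move=> r0 h; rewrite big_nat_cond; apply: (big_ind (fun x => x < r)) => //.
  by move=> x y xr yr; rewrite gt_max xr yr.
by move=> k /andP[/h].
Qed.

Lemma position_split (n k : nat) : (1 <= k < (2 * n).+1)%N ->
  (exists2 y, (y < n)%N & k = n + y.+1)%N \/ (exists2 y, (y < n)%N & k = n - y)%N.
Proof.
move=> hk; case: (ltnP n k) => nk; [left|right].
  by exists (k - n.+1)%N; lia.
by exists (n - k)%N; lia.
Qed.

Lemma fourth_root_errors (R : realType) (e : R) (n : nat) :
  1 <= fourth_root R n -> 2 / fourth_root R n <= e ->
  (fourth_root R n)^-1 ^+ 2 <= e / 2 /\ (n ^ 2)%:R^-1 <= e / 2.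
Proof.
move=> q1 qe; set q := fourth_root R n in q1 qe *; have q0 : 0 < q by lra.
have v0 : 0 < q^-1 by rewrite invr_gt0.
have v1 : q^-1 <= 1 by rewrite invf_le1.
have v2 : q^-1 ^+ 2 <= q^-1 by rewrite expr2 ger_pMl.
have vN : (n ^ 2)%:R^-1 <= q^-1.
  rewrite natrX -fourth_rootE -/q -exprM -exprVn.
  by rewrite -[leRHS]expr1 ler_wiXn2l // ltW.
by split; lra.
Qed.

Lemma first_touch_close (R : realType) (e S c : R) (n m : nat) :
  1 <= fourth_root R n -> 2 / fourth_root R n <= e ->
  `|S - c / 2| <= (fourth_root R n)^-1 ^+ 2 ->
  (0 < m)%N -> c - 2 * e < 1 - 2 * m.-1%:R / (n ^ 2)%:R ->
  1 - 2 * m%:R / (n ^ 2)%:R < c + 2 * e ->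
  `|m%:R / n%:R ^+ 2 - (2^-1 - S)| < 2 * e.
Proof.
move=> q1 qe; have [e1 e2] := fourth_root_errors q1 qe.
case: m => // m hs _ /=; rewrite -natrX -[m.+1%:R]natr1 => h1 h2.
have mD : (m%:R + 1) / (n ^ 2)%:R = m%:R / (n ^ 2)%:R + (n ^ 2)%:R^-1 :> R.
  by rewrite mulrDl mul1r.
move: h1 h2; rewrite -!mulrA mD.
move: hs; rewrite ler_norml ltr_norml => /andP[s1 s2] h1 h2.
by apply/andP; split; lra.
Qed.

Lemma position_product (n y : nat) : (y < n)%N ->
  ((n + y.+1) * (2 * n - (n + y.+1)) = n ^ 2 - y.+1 ^ 2)%N /\
  ((n - y) * (2 * n - (n - y)) = n ^ 2 - y ^ 2)%N.
Proof.
move=> yn; rewrite !subn_sqr; split.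
  by rewrite mulnC; congr (_ * _)%N; lia.
by congr (_ * _)%N; lia.
Qed.

Lemma dev_minus_lt (R : realType) (n : nat) (e : R) (l : 'I_n) (t : instructions n) :
  l.+1 = n -> t \in jump_sequences n -> 0 < e ->
  1 <= fourth_root R n -> 2 / fourth_root R n <= e ->
  ~~ strays e true (stat_last l) t -> ~~ strays e true (@stat_moved n) t ->
  dev_minus R t < 2 * e.
Proof.
move=> lE tO e0 q1 qe s1 s2; have n0 : (0 < n)%N by lia.
apply: bigmax_lt => [|k hk]; first lra.
case: (position_split hk) => -[y yn kE]; have [k1 k2] := position_product yn.
  have [b1 b2 b3] := tau_minus_bracket tO (first_touch_last lE yn tO).
  rewrite kE; have [c1 c2] := strays_bracket s1 yn b1 b2 b3.
  apply: first_touch_close c1 c2 => //; last by case/andP: b1.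
  by apply: (phi_arg_close R yn _ k1); lia.
have [b1 b2 b3] := tau_minus_bracket tO (first_touch_moved yn tO).
rewrite kE; have [c1 c2] := strays_bracket s2 yn b1 b2 b3.
apply: first_touch_close c1 c2 => //; last by case/andP: b1.
by apply: (phi_arg_close R yn _ k2); lia.
Qed.

Lemma reversed_time (N s : nat) : (0 < s <= N)%N -> let m := (N - s.-1)%N in
  [/\ (0 < m <= N)%N, (N - m = s.-1)%N, (N - m.-1 = s)%N, m.-1 = (N - s)%N
    & m = (N - s).+1].
Proof. by move=> h m; rewrite /m; split; lia. Qed.

Lemma dev_plus_lt (R : realType) (n : nat) (e : R) (l : 'I_n) (t : instructions n) :
  l = 0%N :> nat -> t \in jump_sequences n -> 0 < e ->
  1 <= fourth_root R n -> 2 / fourth_root R n <= e ->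
  ~~ strays e false (stat_first l) t -> ~~ strays e false (@stat_unfinished n) t ->
  dev_plus R t < 2 * e.
Proof.
move=> lE tO e0 q1 qe s1 s2; have n0 : (0 < n)%N by have := ltn_ord l; lia.
have N0 : (n ^ 2)%:R != 0 :> R by rewrite pnatr_eq0; lia.
(* Backwards in time, the last touch brackets the reversed statistic in the way a
   first touch does. *)
have main (Y : config n -> nat) (y k : nat) (s := tau_plus t k) :
    ~~ strays e false Y t -> (y < n)%N -> (0 < s <= n ^ 2)%N ->
    (y < Y (config_at t s.-1))%N -> (Y (config_at t s) <= y)%N ->
    `|Num.sqrt (k%:R / (2 * n%:R) * (1 - k%:R / (2 * n%:R))) -
       cos (asin (y%:R / n%:R)) / 2| <= (fourth_root R n)^-1 ^+ 2 ->
    `|s%:R / n%:R ^+ 2 - phi_plus (k%:R / (2 * n%:R))| < 2 * e.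
  move=> st yn s0N b2 b3 close; have /andP[_ sN] := s0N.
  have [mN e1 e2 m1E mE] := reversed_time s0N; set m := (n ^ 2 - s.-1)%N in mN e1 e2 m1E mE.
  have := strays_bracket st yn mN; rewrite /stat_time e1 e2 => /(_ b2 b3) [c1 c2].
  have [r1 r2] := fourth_root_errors q1 qe.
  have hm1 : m.-1%:R / (n ^ 2)%:R = 1 - s%:R / (n ^ 2)%:R :> R.
    by rewrite m1E natrB // mulrBl divff.
  have hm : m%:R / (n ^ 2)%:R = 1 - s%:R / (n ^ 2)%:R + (n ^ 2)%:R^-1 :> R.
    by rewrite mE -natr1 mulrDl mul1r natrB // mulrBl divff.
  move: close c1 c2; rewrite /phi_plus -natrX -!mulrA hm1 hm.
  rewrite ler_norml ltr_norml => /andP[s1' s2'] c1 c2.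
  by apply/andP; split; lra.
apply: bigmax_lt => [|k hk]; first lra.
case: (position_split hk) => -[y yn kE]; have [k1 k2] := position_product yn.
  have [b1 b2 b3] := tau_plus_bracket tO (last_touch_unfinished yn tO).
  by rewrite kE; apply: main b2 b3 _ => //; apply: (phi_arg_close R yn _ k1); lia.
have [b1 b2 b3] := tau_plus_bracket tO (last_touch_first lE yn tO).
by rewrite kE; apply: main b2 b3 _ => //; apply: (phi_arg_close R yn _ k2); lia.
Qed.

(** * The limit theorem *)

Lemma jump_probE (R : realType) (n : nat) (E : {set instructions n}) :
  jump_prob R E = prob R (fun t => t \in E).
Proof.
rewrite /jump_prob /prob /mean -sum1_card natr_sum; congr (_ / _).
rewrite big_mkcond [RHS]big_mkcond; apply: eq_bigr => t _; rewrite inE.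
by case: (t \in jump_sequences n); case: (t \in E).
Qed.

Lemma probU (R : realType) (n : nat) (E F : pred (instructions n)) :
  prob R (fun t => E t || F t) <= prob R E + prob R F.
Proof.
rewrite /prob -meanD; apply: mean_le => t _; rewrite -natrD ler_nat.
by case: (E t) (F t) => [] [].
Qed.

Lemma prob_le1 (R : realType) (n : nat) (E : pred (instructions n)) : prob R E <= 1.
Proof.
rewrite -[leRHS](@mean_cst R n); apply: mean_le => t _.
by case: (E t).
Qed.

Lemma prob_strays_any (R : realType) (e : R) : 0 < e < 1 -> exists C : R, forall n : nat,
  (0 < n)%N -> C <= fourth_root R n -> forall l f : 'I_n, l.+1 = n -> f = 0%N :> nat ->
  prob R (fun t => (strays e true (stat_last l) t || strays e true (@stat_moved n) t) ||
                   (strays e false (stat_first f) t || strays e false (@stat_unfinished n) t))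
  <= 8 * (((n ^ 2).+1 * n)%:R * expR (- (fourth_root R n * e))).
Proof.
move=> e01; have [C hC] := tails e01; exists C => n n0 hn l f lE fE.
have e0 : 0 < e by case/andP: e01.
set x := expR _; have x0 : 0 <= 2 * x by rewrite mulr_ge0 ?expR_ge0.
have T := hC n n0 hn.
have b1 := prob_strays e0 x0 (T _ _ _ _ _ (boundary_stat_last lE) (start_last lE)
  (@boundary_stat_unfinished n) (@start_unfinished n) (dual_last_unfinished lE)).
have b2 := prob_strays e0 x0 (T _ _ _ _ _ (@boundary_stat_moved n) (@start_moved n)
  (boundary_stat_first fE) (start_first fE) (dual_moved_first fE)).
have b3 := prob_strays e0 x0 (T _ _ _ _ _ (boundary_stat_first fE) (start_first fE)
  (@boundary_stat_moved n) (@start_moved n) (dual_first_moved fE)).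
have b4 := prob_strays e0 x0 (T _ _ _ _ _ (@boundary_stat_unfinished n) (@start_unfinished n)
  (boundary_stat_last lE) (start_last lE) (dual_unfinished_last lE)).
apply: (le_trans (probU _ _ _)).
have u1 := @probU R n (strays e true (stat_last l)) (strays e true (@stat_moved n)).
have u2 := @probU R n (strays e false (stat_first f)) (strays e false (@stat_unfinished n)).
lra.
Qed.

(** There are about n^3 = s^12 pairs of a time and a level, with s = n^(1/4), and
    exp (s e) >= (s e / 13)^13. *)
Lemma union_bound_small (R : realType) (e eta : R) : 0 < e -> 0 < eta ->
  exists C : R, forall n : nat, C <= fourth_root R n ->
  8 * (((n ^ 2).+1 * n)%:R * expR (- (fourth_root R n * e))) < eta.
Proof.
move=> e0 eta0; pose K := (13 / e) ^+ 13; have K0 : 0 < K by rewrite exprn_gt0 ?divr_gt0.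
exists (1 + 16 * K / eta) => n; set q := fourth_root R n => hq.
have c0 : 0 < 16 * K / eta by apply: divr_gt0 => //; apply: mulr_gt0.
have q1 : 1 <= q by lra.
have q0 : 0 < q by lra.
have nE : n%:R = q ^+ 4 :> R by rewrite fourth_rootE.
have count : ((n ^ 2).+1 * n)%:R <= 2 * q ^+ 12.
  rewrite natrM -natr1 natrX nE -exprM.
  have : 1 <= q ^+ (4 * 2) by rewrite exprn_ege1.
  have -> : q ^+ 12 = q ^+ (4 * 2) * q ^+ 4 by rewrite -exprD.
  have : 0 < q ^+ 4 by rewrite exprn_gt0.
  by move: (q ^+ 4) (q ^+ (4 * 2)) => a b; nra.
have expo : expR (- (q * e)) <= K / q ^+ 13.
  have -> : q * e = 13%:R * (q * e / 13) by field.
  rewrite expRN expRM_natl -[leRHS]invrK lef_pV2 ?posrE ?exprn_gt0 ?expR_gt0 //; last first.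
    by rewrite invr_gt0 divr_gt0 // exprn_gt0.
  have -> : (K / q ^+ 13)^-1 = (q * e / 13) ^+ 13.
    by rewrite /K -expr_div_n -exprVn; congr (_ ^+ _); field; rewrite !lt0r_neq0.
  rewrite lerXn2r ?nnegrE ?expR_ge0 ?divr_ge0 ?mulr_ge0 ?(ltW e0) ?(ltW q0) //.
  by apply: le_trans (expR_ge1Dx _); rewrite lerDr.
apply: (@le_lt_trans _ _ (8 * (2 * q ^+ 12 * (K / q ^+ 13)))).
  by rewrite ler_wpM2l // ler_pM ?expR_ge0.
have -> : 8 * (2 * q ^+ 12 * (K / q ^+ 13)) = 16 * K / q.
  by field; rewrite lt0r_neq0.
by rewrite ltr_pdivrMr // [eta * q]mulrC -ltr_pdivrMr //; apply: lt_le_trans hq; rewrite ltrDr.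
Qed.

Theorem theorem2 (R : realType) (eps : R) (heps : 0 < eps) :
  (fun n : nat =>
     jump_prob R ([set s : instructions n | dev_minus R s < eps]
                  :&: [set s : instructions n | dev_plus R s < eps])%SET)
    @ \oo --> (1 : R).
Proof.
pose e := Num.min (eps / 2) (1 / 2).
have e0 : 0 < e by rewrite lt_min !divr_gt0.
have ee : 2 * e <= eps by have : e <= eps / 2; [by rewrite ge_min lexx|lra].
have e1 : e < 1 by have : e <= 1 / 2; [by rewrite ge_min lexx orbT|lra].
have e01 : 0 < e < 1 by rewrite e0.
have [C1 hC1] := prob_strays_any e01.
apply/cvgrPdist_lt => eta eta0; have [C2 hC2] := union_bound_small e0 eta0.
near=> n.
have n0 : (0 < n)%N by near: n; exact: nbhs_infty_gt.
have q1 : 1 <= fourth_root R n by near: n; exact: near_fourth_root.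
have q2 : C1 <= fourth_root R n by near: n; exact: near_fourth_root.
have q3 : C2 <= fourth_root R n by near: n; exact: near_fourth_root.
have q4 : 2 / e <= fourth_root R n by near: n; exact: near_fourth_root.
have qe : 2 / fourth_root R n <= e.
  by rewrite ler_pdivrMr ?(lt_le_trans ltr01) // mulrC -ler_pdivrMr.
have nn : (n.-1 < n)%N by rewrite ltn_predL.
pose l := Ordinal nn; pose f := Ordinal n0.
have lE : l.+1 = n by rewrite /= prednK.
have := le_lt_trans (hC1 n n0 q2 l f lE erefl) (hC2 n q3).
set bad := (fun t => _ || _); set E := (_ :&: _)%SET => hbad.
have EE : 1 <= prob R (fun t => t \in E) + prob R bad.
  rewrite -[leLHS](@mean_cst R n) -meanD; apply: mean_le => t tO.
  rewrite -natrD ler1n; case: (boolP (bad t)) => bt; first by rewrite addn1.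
  move: bt; rewrite /bad !negb_or => /andP[/andP[s1 s2] /andP[s3 s4]].
  rewrite !inE (lt_le_trans (dev_minus_lt lE tO e0 q1 qe s1 s2) ee).
  by rewrite (lt_le_trans (dev_plus_lt (l := f) erefl tO e0 q1 qe s3 s4) ee).
have E1 := prob_le1 R (fun t => t \in E).
rewrite jump_probE ger0_norm ?subr_ge0 //; lra.
Unshelve. all: by end_near. Qed.
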